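(* Let $\tau\in\mathbb{C}$ with $\mathrm{Im}\,\tau>0$. Let $\iota:\mathbb{C}\to\mathbb{P}^n$, $u\mapsto(f_0(u):f_1(u):\cdots:f_n(u))$, be a holomorphic map, where $f_0,\dots,f_n$ are holomorphic functions on $\mathbb{C}$ such that (i) the $f_i$ all have the same quasi-periodicity with respect to $\mathbb{Z}+\mathbb{Z}\tau$; (ii) the $f_i$ are linearly independent over $\mathbb{C}$; (iii) each $f_i$ has $n+1$ zeros (counted with multiplicity) in the fundamental domain. Let $\iota':\mathbb{C}\to\mathbb{P}^n$, $u\mapsto(f_0'(u):f_1'(u):\cdots:f_n'(u))$, be another holomorphic map such that the holomorphic functions $f_0',\dots,f_n'$ (the prime does not denote a derivative) also satisfy (i), (ii), (iii) with the same $\tau$, where the common quasi-periodicity of the $f_i'$ need not be the same as that of the $f_i$. Let $u_0,u_1,\dots,u_n$ be the zeros of $f_0(u)$ and let $u_0',u_1',\dots,u_n'$ be the zeros of $f_0'(u)$ in the fundamental domain (with multiplicity). Put $$a=\frac{1}{n+1}\left(u_0'+u_1'+\cdots+u_n'-u_0-u_1-\cdots-u_n\right).$$ Then there exists a projective linear transformation $G\in\mathrm{PGL}(n+1)$ such that $\iota(u)\,G=\iota'(u+a)$ for all $u\in\mathbb{C}$.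
   Context: A holomorphic function $f$ on $\mathbb{C}$ has quasi-periodicity (with respect to $\mathbb{Z}+\mathbb{Z}\tau$) if there exist constants $l_1,l_\tau,c_1,c_\tau\in\mathbb{C}$ such that $$f(u+1)=f(u)\exp\{2\pi\sqrt{-1}(l_1u+c_1)\},\qquad f(u+\tau)=f(u)\exp\{2\pi\sqrt{-1}(l_\tau u+c_\tau)\}$$ for all $u$. Several functions have the same quasi-periodicity if these formulas hold for all of them with the same multipliers $\exp\{2\pi\sqrt{-1}(l_1u+c_1)\}$ and $\exp\{2\pi\sqrt{-1}(l_\tau u+c_\tau)\}$. The fundamental domain is a (half-open) fundamental parallelogram for the lattice $\mathbb{Z}+\mathbb{Z}\tau$ in $\mathbb{C}$. Here $\mathrm{PGL}(n+1)=\mathrm{PGL}(n+1,\mathbb{C})$ acts on points of $\mathbb{P}^n$, written as row vectors of homogeneous coordinates, by right multiplication. *)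

(* Defs.v *)
From HB Require Import structures.
From mathcomp Require Import all_boot all_order all_algebra.
From mathcomp Require Import generic_quotient.
From mathcomp Require Import complex.
From mathcomp Require Import all_classical all_reals all_analysis.

Set Implicit Arguments.
Unset Strict Implicit.
Unset Printing Implicit Defensive.

Import Order.TTheory GRing.Theory Num.Theory.
Import numFieldNormedType.Exports.

Local Open Scope classical_set_scope.
Local Open Scope quotient_scope.
Local Open Scope complex_scope.
Local Open Scope ring_scope.

Section Projective.
Variables (K : fieldType) (n : nat).

Record hvec := HVec { hvec_val :> 'rV[K]_n.+1; hvecP : hvec_val != 0 }.
HB.instance Definition _ := [isSub for hvec_val].
HB.instance Definition _ := [Choice of hvec by <:].

Definition hvec_equiv (v w : hvec) : bool :=
  `[< exists2 c : K, c != 0 & hvec_val w = c *: hvec_val v >].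

Lemma hvec_equiv_refl : reflexive hvec_equiv.
Proof. by move=> v; apply/asboolP; exists 1; rewrite ?oner_neq0 ?scale1r. Qed.

Lemma hvec_equiv_sym : symmetric hvec_equiv.
Proof.
move=> v w; apply/asboolP/asboolP => -[c c0 e];
  by exists c^-1; rewrite ?invr_eq0 // e scalerA mulVf // scale1r.
Qed.

Lemma hvec_equiv_trans : transitive hvec_equiv.
Proof.
move=> w v x /asboolP[c c0 e] /asboolP[d d0 e']; apply/asboolP.
by exists (d * c); rewrite ?mulf_neq0 // e' e scalerA.
Qed.

Canonical hvec_equiv_equiv :=
  EquivRel hvec_equiv hvec_equiv_refl hvec_equiv_sym hvec_equiv_trans.

Definition proj_space := {eq_quot hvec_equiv}.

Definition proj_point (v : 'rV[K]_n.+1) (v0 : v != 0) : proj_space :=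
  \pi_proj_space (HVec v0).

Record GLmx := GLMx { GLmx_val :> 'M[K]_n.+1; GLmxP : GLmx_val \in unitmx }.
HB.instance Definition _ := [isSub for GLmx_val].
HB.instance Definition _ := [Choice of GLmx by <:].

Definition GLmx_equiv (A B : GLmx) : bool :=
  `[< exists2 c : K, c != 0 & GLmx_val B = c *: GLmx_val A >].

Lemma GLmx_equiv_refl : reflexive GLmx_equiv.
Proof. by move=> v; apply/asboolP; exists 1; rewrite ?oner_neq0 ?scale1r. Qed.

Lemma GLmx_equiv_sym : symmetric GLmx_equiv.
Proof.
move=> v w; apply/asboolP/asboolP => -[c c0 e];
  by exists c^-1; rewrite ?invr_eq0 // e scalerA mulVf // scale1r.
Qed.

Lemma GLmx_equiv_trans : transitive GLmx_equiv.
Proof.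
move=> w v x /asboolP[c c0 e] /asboolP[d d0 e']; apply/asboolP.
by exists (d * c); rewrite ?mulf_neq0 // e' e scalerA.
Qed.

Canonical GLmx_equiv_equiv :=
  EquivRel GLmx_equiv GLmx_equiv_refl GLmx_equiv_sym GLmx_equiv_trans.

(* [PGL] is PGL(n+1, K), acting on the n-dimensional [proj_space]. *)
Definition PGL := {eq_quot GLmx_equiv}.

Lemma hvec_mul_neq0 (v : hvec) (A : GLmx) : v *m A != 0.
Proof.
apply/eqP => vA0; case/eqP: (hvecP v).
by rewrite -(mulmxK (GLmxP A) v) vA0 mul0mx.
Qed.

Definition PGL_act (x : proj_space) (G : PGL) : proj_space :=
  proj_point (hvec_mul_neq0 (repr x) (repr G)).

Lemma proj_pointP (v w : 'rV[K]_n.+1) (v0 : v != 0) (w0 : w != 0) :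
  proj_point v0 = proj_point w0 <-> exists2 c : K, c != 0 & w = c *: v.
Proof.
split => [/eqmodP/asboolP //|vw].
by apply/eqmodP/asboolP.
Qed.

(* [PGL_act] does not depend on the representatives. *)
Lemma PGL_actE (v : hvec) (A : GLmx) :
  PGL_act (\pi_proj_space v) (\pi_PGL A) = proj_point (hvec_mul_neq0 v A).
Proof.
have /eqmodP/asboolP[c c0 ev] : repr (\pi_proj_space v) = v %[mod proj_space].
  by rewrite reprK.
have /eqmodP/asboolP[d d0 eA] : repr (\pi_PGL A) = A %[mod PGL].
  by rewrite reprK.
apply/proj_pointP; exists (c * d); first by rewrite mulf_neq0.
by rewrite ev eA -scalemxAl -scalemxAr scalerA.
Qed.

End Projective.

Section EllipticFunctions.
Variable R : realType.
Local Notation C := R[i].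

Definition entire (f : C -> C) : Prop :=
  forall z : C, derivable (f : C^o -> C^o) z 1.

Definition cexp (z : C) : C :=
  (expR (complex.Re z))%:C * (cos (complex.Im z) +i* sin (complex.Im z)).

Definition same_quasi_periodicity (tau : C) (I : Type) (f : I -> C -> C) :
    Prop :=
  exists l1 ltau c1 ctau : C, forall (i : I) (u : C),
    f i (u + 1) = f i u * cexp (2 * pi%:C * 'i * (l1 * u + c1)) /\
    f i (u + tau) = f i u * cexp (2 * pi%:C * 'i * (ltau * u + ctau)).

Definition linearly_independent (n : nat) (f : 'I_n -> C -> C) : Prop :=
  forall c : 'I_n -> C,
    (forall u : C, \sum_(i < n) c i * f i u = 0) -> forall i, c i = 0.

(* For [m = 0] this says that [z] is not a zero of [f]. *)
Definition zero_order (f : C -> C) (z : C) (m : nat) : Prop :=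
  exists g : C -> C,
    [/\ g z != 0,
        \forall u \near (z : C^o), derivable (g : C^o -> C^o) u 1 &
        \forall u \near (z : C^o), f u = (u - z) ^+ m * g u].

(* [zs] lists the zeros of [f] lying in [D], repeated with multiplicity. *)
Definition zeros_in (D : set C) (f : C -> C) (zs : seq C) : Prop :=
  (forall z, z \in zs -> D z) /\
  (forall z, D z -> zero_order f z (count_mem z zs)).

Definition lattice (w1 w2 : C) : set C :=
  [set w | exists k l : int, w = k%:~R * w1 + l%:~R * w2].

(* The corner [c] and the basis [w1, w2] of Z + Z tau are arbitrary; replacing
   [w1] or [w2] by its opposite changes which of the parallel sides belong to
   the half-open parallelogram. *)
Definition fundamental_parallelogram (tau : C) (D : set C) : Prop :=
  exists c w1 w2 : C,
    lattice w1 w2 = lattice 1 tau /\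
    D = [set z | exists s t : R,
           [/\ 0 <= s < 1, 0 <= t < 1 & z = c + s%:C * w1 + t%:C * w2]].

Definition coords (n : nat) (f : 'I_n.+1 -> C -> C) (u : C) : 'rV[C]_n.+1 :=
  \row_i f i u.

(* The map u |-> (f_0(u) : ... : f_n(u)); it is only defined when the [f i]
   have no common zero. *)
Definition proj_map (n : nat) (f : 'I_n.+1 -> C -> C)
    (f_neq0 : forall u, coords f u != 0) (u : C) : proj_space C n :=
  proj_point (f_neq0 u).

End EllipticFunctions.

(* Main.v *)
(* Write e(z) = exp(2 i pi z).  After multiplication by a Gaussian, the
   functions f_i are 1-periodic and satisfy f(u + tau) = f(u) e(- N u - s) for
   some integer N.  The Fourier coefficients a_k of such a function satisfy
   a_(k+N) = e(s + k tau) a_k.  Hence there is no nonzero one if N < 0; if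
   N = 0, a nonzero one forces s into the lattice; and if N > 0 it is determined
   by a_0, ..., a_(N-1).  Dividing f_0 by the product of the theta functions
   vanishing at its zeros gives an entire function without zeros which is
   quasi-periodic in the same sense, as is its inverse: so N = n+1, and
   s + sum u_i + (n+1)/2 lies in the lattice.  Translating the f'_i by a and
   multiplying by some e(l u) thus brings them into the same space as the f_i,
   and both families are bases of this space of dimension n+1. *)

Require Import Defs.
From HB Require Import structures.
From mathcomp Require Import all_boot all_order all_algebra.
From mathcomp Require Import generic_quotient.
From mathcomp Require Import complex.
From mathcomp Require Import all_classical all_reals all_analysis.
From mathcomp Require Import zify ring lra.

Set Implicit Arguments.
Unset Strict Implicit.
Unset Printing Implicit Defensive.

Import Order.TTheory GRing.Theory Num.Theory.
Import numFieldNormedType.Exports.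

Local Open Scope classical_set_scope.
Local Open Scope complex_scope.
Local Open Scope ring_scope.

(** * Complex derivatives *)

Section Modulus.
Variable R : realType.
Local Notation C := R[i].
Implicit Types (x y z w h d : C) (f g : C -> C).

(** Division by a theta product plays the part of the argument principle: a contour along the
    boundary of the parallelogram could meet zeros, whereas the orders of the theta product are
    known at every point of the plane. The only contour argument left is Goursat's theorem on
    rectangles of width one. By 1-periodicity the vertical sides cancel, so a Fourier coefficient
    may be computed on any horizontal line, and moving the line by [tau] gives the recurrence. The
    integrality of N expresses that translating by 1 and then by [tau], or in the other order,
    yields the same value. The form of [a] comes from the rule that translation by b adds N b to s.
    With N = n+1, both s + sum u_i + (n+1)/2 and its primed analogue lie in the lattice; the halves
    cancel, and s' + (n+1) a - s is a lattice point k + l tau. The integer k does not change the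
    multiplier, and l tau is absorbed by the factor e(l u). The dimension n+1 is used only as an
    upper bound: n+1 independent functions then have an invertible matrix of Fourier
    coefficients. *)

Definition nm z : R := Normc.normc z.

Lemma normE z : `|z| = (nm z)%:C.
Proof. by rewrite normc_def; case: z. Qed.

Lemma nm_ge0 z : 0 <= nm z.
Proof. by rewrite -lecR -normE; exact: normr_ge0. Qed.

Lemma nm0 : nm 0 = 0.
Proof. exact: Normc.normc0. Qed.

Lemma nm1 : nm 1 = 1.
Proof. exact: Normc.normc1. Qed.

Lemma nm_eq0 z : (nm z == 0) = (z == 0).
Proof. by rewrite -(inj_eq (@complexI R)) -normE normr_eq0. Qed.

Lemma nm_gt0 z : (0 < nm z) = (z != 0).
Proof. by rewrite lt_def nm_ge0 andbT nm_eq0. Qed.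

Lemma nmM z w : nm (z * w) = nm z * nm w.
Proof. exact: Normc.normcM. Qed.

Lemma nmV z : nm z^-1 = (nm z)^-1.
Proof. exact: Normc.normcV. Qed.

Lemma nmX z k : nm (z ^+ k) = nm z ^+ k.
Proof. by elim: k => [|k IH]; rewrite ?expr0 ?nm1 // !exprS nmM IH. Qed.

Lemma nmN z : nm (- z) = nm z.
Proof. by apply: (@complexI R); rewrite -!normE normrN. Qed.

Lemma nmD z w : nm (z + w) <= nm z + nm w.
Proof. by rewrite -lecR -normE rmorphD; exact: ler_normD. Qed.

Lemma nmB z w : nm (z - w) <= nm z + nm w.
Proof. by rewrite -(nmN w) nmD. Qed.

Lemma nmBC z w : nm (z - w) = nm (w - z).
Proof. by rewrite -nmN opprB. Qed.

Lemma nmR (r : R) : nm r%:C = `|r|.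
Proof. by rewrite /nm /= expr0n addr0 sqrtr_sqr. Qed.

Lemma nmn (k : nat) : nm k%:R = k%:R.
Proof. by rewrite -(rmorph_nat (real_complex R)) nmR normr_nat. Qed.

Lemma nmi : nm (0 +i* 1) = 1.
Proof. by rewrite /nm /= expr0n expr1n add0r sqrtr1. Qed.

Lemma Re_le_nm z : `|complex.Re z| <= nm z.
Proof. by rewrite -lecR -normE normc_ge_Re. Qed.

Lemma Im_le_nm z : `|complex.Im z| <= nm z.
Proof.
case: z => a b; have := Re_le_nm (b -i* a).
by rewrite /nm /= sqrrN addrC.
Qed.

Lemma nm_le_ReIm z : nm z <= `|complex.Re z| + `|complex.Im z|.
Proof.
case: z => a b; have e : a +i* b = a%:C + (0 +i* 1) * b%:C.
  by apply/eqP; rewrite eq_complex /=; apply/andP; split; apply/eqP; ring.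
by rewrite [in leLHS]e (le_trans (nmD _ _)) // nmM nmi mul1r !nmR.
Qed.

End Modulus.

(** * Complex differentiability in epsilon form *)

Section ComplexDerivative.
Variable R : realType.
Local Notation C := R[i].
Implicit Types (x y z w h d : C) (f g : C -> C).

Definition cderiv f z d := forall e : R, 0 < e -> exists2 k : R, 0 < k &
  forall h, nm h < k -> nm (f (z + h) - f z - d * h) <= e * nm h.

Definition holo f z := exists d, cderiv f z d.

Definition holo_near f z :=
  exists2 k : R, 0 < k & forall u, nm (u - z) < k -> holo f u.

Lemma near_nm (P : C -> Prop) z :
  (\forall u \near (z : C^o), P u) ->
  exists2 k : R, 0 < k & forall u, nm (u - z) < k -> P u.
Proof.
move=> /nbhs_ballP[k /= k0 H].
(* In the partial order of [C], [0 < k] forces [k] to be real, so its real part can serve as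
   radius. *)
move: (k0); rewrite ltcE /= => /andP[/eqP kI kR].
exists (complex.Re k) => // u uz; apply: H.
rewrite -ball_normE /ball_ /= normE nmBC.
by rewrite ltcE /= kI eqxx.
Qed.

Lemma derivable_holo f z : derivable (f : C^o -> C^o) z 1 -> holo f z.
Proof.
move=> /cvg_ex[d /= fd]; exists d => e e0.
have ec0 : 0 < e%:C :> C by rewrite ltcR.
move/cvgrPdist_lt: fd => /(_ _ ec0) fd.
have [k k0 H] := @near_nm _ (0 : C) fd.
exists k => // h hk; have [->|h0] := eqVneq h 0.
  by rewrite addr0 subrr mulr0 subrr nm0 mulr0.
have := H h; rewrite subr0 => /(_ hk h0).
rewrite normE ltcR /= nmBC /= => /ltW q.
have -> : f (z + h) - f z - d * h
   = (h^-1 *: ((f (h *: 1 + z) : C^o) - f z) - d) * h.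
  rewrite mulrBl; congr (_ - _).
  rewrite /GRing.scale /= mulr1 [h + z]addrC. by rewrite mulrAC mulVf // mul1r.
by rewrite nmM ler_wpM2r // nm_ge0.
Qed.

Lemma cderiv_ext f g z d (k : R) : 0 < k ->
  (forall u, nm (u - z) < k -> f u = g u) -> cderiv f z d -> cderiv g z d.
Proof.
move=> k0 fg fd e e0; have [l l0 H] := fd e e0.
exists (Num.min k l) => [|h]; first by rewrite lt_min k0.
rewrite lt_min => /andP[hk hl].
by rewrite -!fg ?H // ?subrr ?nm0 // addrC addKr.
Qed.

Lemma cderiv_quad f z d (K k : R) : 0 < k ->
  (forall h, nm h < k -> nm (f (z + h) - f z - d * h) <= K * nm h ^+ 2) ->
  cderiv f z d.
Proof.
move=> k0 H e e0; have K1 : 0 < `|K| + 1 by have := normr_ge0 K; lra.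
exists (Num.min k (e / (`|K| + 1))) => [|h].
  by rewrite lt_min k0 divr_gt0.
rewrite lt_min => /andP[hk]; rewrite ltr_pdivlMr // => he.
apply: le_trans (H _ hk) _; rewrite expr2 mulrA ler_wpM2r ?nm_ge0 //.
by have := nm_ge0 h; have := ler_norm K; nra.
Qed.

Lemma cderiv_lip f z d : cderiv f z d -> exists2 K : R, 0 < K &
  exists2 k : R, 0 < k & forall h, nm h < k -> nm (f (z + h) - f z) <= K * nm h.
Proof.
move=> fd; have [k k0 H] := fd 1 ltr01.
exists (nm d + 1); first by have := nm_ge0 d; lra.
exists k => // h /H; have := nmD (f (z + h) - f z - d * h) (d * h).
by rewrite subrK nmM; lra.
Qed.

Lemma cderiv_cont f z d : cderiv f z d -> forall e : R, 0 < e ->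
  exists2 k : R, 0 < k & forall u, nm (u - z) < k -> nm (f u - f z) < e.
Proof.
move=> /cderiv_lip[K K0 [k k0 H]] e e0.
exists (Num.min k (e / K)) => [|u]; first by rewrite lt_min k0 divr_gt0.
rewrite lt_min => /andP[hk]; rewrite ltr_pdivlMr // => he.
by have := H _ hk; rewrite [z + _]addrC subrK; lra.
Qed.

Lemma cderiv_cst c z : cderiv (fun=> c) z 0.
Proof.
by apply: (@cderiv_quad _ _ _ 0 1) => // h _; rewrite subrr mul0r subrr nm0 mul0r.
Qed.

Lemma cderiv_id z : cderiv id z 1.
Proof.
apply: (@cderiv_quad _ _ _ 0 1) => // h _.
by rewrite (_ : id (z + h) - id z - 1 * h = 0) ?nm0 ?mul0r //=; ring.
Qed.

Lemma cderivD f g z d d' : cderiv f z d -> cderiv g z d' ->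
  cderiv (fun u => f u + g u) z (d + d').
Proof.
move=> fd gd e e0; have e2 : 0 < e / 2 by lra.
have [k k0 H] := fd _ e2; have [l l0 H'] := gd _ e2.
exists (Num.min k l) => [|h]; first by rewrite lt_min k0.
rewrite lt_min => /andP[/H hk /H' hl].
have -> : f (z + h) + g (z + h) - (f z + g z) - (d + d') * h =
  (f (z + h) - f z - d * h) + (g (z + h) - g z - d' * h) by ring.
by have := nmD (f (z + h) - f z - d * h) (g (z + h) - g z - d' * h); lra.
Qed.

Lemma cderivM f g z d d' : cderiv f z d -> cderiv g z d' ->
  cderiv (fun u => f u * g u) z (d * g z + f z * d').
Proof.
move=> fd gd e e0.
have [K K0 [k1 k10 H1]] := cderiv_lip fd.
have [L L0 [k2 k20 H2]] := cderiv_lip gd.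
pose M := nm (f z) + nm (g z) + 1.
have M0 : 0 < M by rewrite /M; have := nm_ge0 (f z); have := nm_ge0 (g z); lra.
have e2 : 0 < e / 2 / M by rewrite divr_gt0 //; lra.
have [k3 k30 H3] := fd _ e2; have [k4 k40 H4] := gd _ e2.
pose k5 := e / 2 / (K * L).
have k50 : 0 < k5 by rewrite divr_gt0 ?mulr_gt0 //; lra.
exists (Num.min k5 (Num.min (Num.min k1 k2) (Num.min k3 k4))) => [|h].
  by rewrite !lt_min k50 k10 k20 k30 k40.
rewrite !lt_min => /and3P[h5 /andP[/H1 h1 /H2 h2] /andP[/H3 h3 /H4 h4]].
set a := f (z + h) - f z in h1 h3 *; set b := g (z + h) - g z in h2 h4.
have -> : f (z + h) * g (z + h) - f z * g z - (d * g z + f z * d') * h =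
  (a - d * h) * g z + f z * (b - d' * h) + a * b by rewrite /a /b; ring.
apply: le_trans (nmD _ _) _; apply: le_trans (lerD (nmD _ _) (lexx _)) _.
rewrite !nmM.
have hh := nm_ge0 h.
have A1 : nm (a - d * h) * nm (g z) <= (e / 2 / M * nm h) * nm (g z).
  by rewrite ler_wpM2r // nm_ge0.
have A2 : nm (f z) * nm (b - d' * h) <= nm (f z) * (e / 2 / M * nm h).
  by rewrite ler_wpM2l // nm_ge0.
have A3 : nm a * nm b <= (K * nm h) * (L * nm h).
  by rewrite ler_pM // ?nm_ge0.
have A4 : (K * nm h) * (L * nm h) <= e / 2 * nm h.
  have -> : K * nm h * (L * nm h) = (nm h * (K * L)) * nm h by ring.
  rewrite ler_wpM2r //; move: h5; rewrite /k5 ltr_pdivlMr ?mulr_gt0 //.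
  by move/ltW.
have A5 : (e / 2 / M * nm h) * nm (g z) + nm (f z) * (e / 2 / M * nm h)
    <= e / 2 * nm h.
  have -> : e / 2 / M * nm h * nm (g z) + nm (f z) * (e / 2 / M * nm h)
     = (e / 2 / M * nm h) * (nm (f z) + nm (g z)) by ring.
  have -> : e / 2 * nm h = (e / 2 / M * nm h) * M by field; rewrite gt_eqF.
  rewrite ler_wpM2l //; last by rewrite /M; lra.
  by rewrite mulr_ge0 // ltW.
lra.
Qed.

Lemma cderiv_comp f g z d d' : cderiv f (g z) d -> cderiv g z d' ->
  cderiv (fun u => f (g u)) z (d * d').
Proof.
move=> fd gd e e0.
have [L L0 [k2 k20 H2]] := cderiv_lip gd.
have e1 : 0 < e / 2 / L by rewrite divr_gt0 //; lra.
have M0 : 0 < nm d + 1 by have := nm_ge0 d; lra.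
have e2 : 0 < e / 2 / (nm d + 1) by rewrite divr_gt0 //; lra.
have [k3 k30 H3] := fd _ e1; have [k4 k40 H4] := gd _ e2.
have k50 : 0 < k3 / L by rewrite divr_gt0.
exists (Num.min (k3 / L) (Num.min k2 k4)) => [|h].
  by rewrite !lt_min k50 k20 k40.
rewrite !lt_min => /and3P[h5 /H2 h2 /H4 h4].
rewrite ltr_pdivlMr // in h5.
set b := g (z + h) - g z in h2 h4.
have hb : nm b < k3 by apply: le_lt_trans h2 _; rewrite mulrC.
have := H3 _ hb; have -> : g z + b = g (z + h) by rewrite /b; ring.
move=> h3.
have -> : f (g (z + h)) - f (g z) - d * d' * h =
  (f (g (z + h)) - f (g z) - d * b) + d * (b - d' * h) by ring.
apply: le_trans (nmD _ _) _; rewrite nmM.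
have hh := nm_ge0 h.
have A1 : e / 2 / L * nm b <= e / 2 / L * (L * nm h) by rewrite ler_wpM2l // ltW.
have A2 : nm d * nm (b - d' * h) <= nm d * (e / 2 / (nm d + 1) * nm h).
  by rewrite ler_wpM2l // nm_ge0.
have A3 : e / 2 / L * (L * nm h) = e / 2 * nm h by field; rewrite gt_eqF.
have A4 : nm d * (e / 2 / (nm d + 1) * nm h) <= e / 2 * nm h.
  have -> : e / 2 * nm h = (nm d + 1) * (e / 2 / (nm d + 1) * nm h).
    by field; rewrite gt_eqF.
  by rewrite ler_wpM2r ?lerDl // mulr_ge0 // ltW.
lra.
Qed.

Lemma cderiv_inv w : w != 0 -> cderiv (fun u => u^-1) w (- w ^- 2).
Proof.
move=> w0; have nw : 0 < nm w by rewrite nm_gt0.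
(* For [nm h < nm w / 2] the modulus of [w + h] stays above [nm w / 2]; the remainder is
   [h ^+ 2 / (w ^+ 2 * (w + h))], whence the constant. *)
apply: (@cderiv_quad _ _ _ (2 / nm w ^+ 3) (nm w / 2)); first lra.
move=> h hk; have nwh : nm w / 2 <= nm (w + h).
  by have := nmB (w + h) h; rewrite addrK; lra.
have wh0 : w + h != 0 by rewrite -nm_gt0; lra.
have -> : (w + h)^-1 - w^-1 - - w ^- 2 * h = h ^+ 2 / (w ^+ 2 * (w + h)).
  by field; rewrite w0 wh0.
rewrite nmM nmV nmM !nmX mulrC ler_wpM2r ?exprn_ge0 ?nm_ge0 //.
have -> : 2 / nm w ^+ 3 = (nm w ^+ 2 * (nm w / 2))^-1 by field; rewrite gt_eqF.
rewrite lef_pV2 ?posrE ?mulr_gt0 ?exprn_gt0 ?divr_gt0 //; last lra.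
by rewrite ler_wpM2l // exprn_ge0 // ltW.
Qed.

Lemma holo_ext f g z (k : R) : 0 < k ->
  (forall u, nm (u - z) < k -> f u = g u) -> holo f z -> holo g z.
Proof. by move=> k0 fg [d] fd; exists d; exact: cderiv_ext fg fd. Qed.

Lemma holo_cst c z : holo (fun=> c) z.
Proof. by exists 0; exact: cderiv_cst. Qed.

Lemma holo_id z : holo id z.
Proof. by exists 1; exact: cderiv_id. Qed.

Lemma holoD f g z : holo f z -> holo g z -> holo (fun u => f u + g u) z.
Proof. by move=> [d fd] [d' gd]; exists (d + d'); exact: cderivD. Qed.

Lemma holoM f g z : holo f z -> holo g z -> holo (fun u => f u * g u) z.
Proof. by move=> [d fd] [d' gd]; eexists; apply: cderivM fd gd. Qed.

Lemma holo_comp f g z : holo f (g z) -> holo g z -> holo (fun u => f (g u)) z.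
Proof. by move=> [d fd] [d' gd]; exists (d * d'); exact: cderiv_comp. Qed.

Lemma holoN f z : holo f z -> holo (fun u => - f u) z.
Proof.
move=> fd; have := holoM (holo_cst (-1) z) fd.
by apply: (@holo_ext _ _ _ 1) => // u _; rewrite mulN1r.
Qed.

Lemma holoB f g z : holo f z -> holo g z -> holo (fun u => f u - g u) z.
Proof. by move=> fd gd; apply: holoD fd (holoN gd). Qed.

Lemma holoX f z k : holo f z -> holo (fun u => f u ^+ k) z.
Proof.
move=> fd; elim: k => [|k IH]; first exact: holo_cst.
by have := holoM fd IH; apply: (@holo_ext _ _ _ 1) => // u _; rewrite exprS.
Qed.

Lemma holo_inv f z : f z != 0 -> holo f z -> holo (fun u => (f u)^-1) z.
Proof.
move=> fz0; apply: (@holo_comp (fun u => u^-1)).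
by exists (- f z ^- 2); exact: cderiv_inv.
Qed.

Lemma holo_neq0 f z : holo f z -> f z != 0 ->
  exists2 k : R, 0 < k & forall u, nm (u - z) < k -> f u != 0.
Proof.
move=> [d fd] fz; have := cderiv_cont fd; rewrite -nm_gt0 in fz.
move=> /(_ _ fz)[k k0 H]; exists k => // u /H.
by apply: contraTneq => ->; rewrite sub0r nmN ltxx.
Qed.

End ComplexDerivative.

(** * Paths and the exponential *)

Section PathDerivative.
Variable R : realType.
Local Notation C := R[i].
Implicit Types (z w : C) (f : C -> C) (p : R -> C) (g : R -> R) (t a b : R).

Lemma is_deriveP g t d : is_derive t (1 : R) g d <->
  forall e : R, 0 < e -> exists2 k : R, 0 < k &
    forall s, `|s| < k -> `|g (t + s) - g t - d * s| <= e * `|s|.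
Proof.
split=> [gd e e0|H].
  have : h^-1 *: ((g \o shift t) (h *: (1 : R)) - g t) @[h --> 0^'] --> d.
    by rewrite -(@derive_val _ _ _ _ _ _ _ gd); exact: (@ex_derive _ _ _ _ _ _ _ gd).
  move=> /cvgrPdist_lt /(_ _ e0) /nbhs_ballP[k /= k0 H].
  exists k => // s sk; have [->|s0] := eqVneq s 0.
    by rewrite addr0 mulr0 !subrr normr0 mulr0.
  have := H s; rewrite /ball /= sub0r normrN => /(_ sk s0) /ltW.
  rewrite distrC /GRing.scale /= mulr1 [s + t]addrC => q.
  have -> : g (t + s) - g t - d * s = (s^-1 * (g (t + s) - g t) - d) * s.
    by rewrite mulrBl mulrAC mulVf // mul1r.
  by rewrite normrM ler_wpM2r.
have cv : h^-1 *: ((g \o shift t) (h *: (1 : R)) - g t) @[h --> 0^'] --> d.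
  apply/cvgrPdist_le => e e0; have [k k0 Hk] := H e e0.
  apply/nbhs_ballP; exists k => //= s; rewrite /ball /= sub0r normrN => sk s0.
  rewrite distrC /GRing.scale /= mulr1 [s + t]addrC.
  have := Hk _ sk.
  have -> : g (t + s) - g t - d * s = (s^-1 * (g (t + s) - g t) - d) * s.
    by rewrite mulrBl mulrAC mulVf // mul1r.
  by rewrite normrM ler_pM2r ?normr_gt0.
by split; [apply/cvg_ex; exists d | exact: cvg_lim cv].
Qed.

Definition pderiv p t (d : C) :=
  is_derive t (1 : R) (fun s => complex.Re (p s)) (complex.Re d) /\
  is_derive t (1 : R) (fun s => complex.Im (p s)) (complex.Im d).

Lemma pderivP p t d : pderiv p t d <->
  forall e : R, 0 < e -> exists2 k : R, 0 < k &
    forall s, `|s| < k -> nm (p (t + s) - p t - d * s%:C) <= e * `|s|.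
Proof.
have ReE s : complex.Re (p (t + s)) - complex.Re (p t) - complex.Re d * s
    = complex.Re (p (t + s) - p t - d * s%:C).
  by case: (p (t + s)) (p t) (d) => [? ?] [? ?] [? ?] /=; ring.
have ImE s : complex.Im (p (t + s)) - complex.Im (p t) - complex.Im d * s
    = complex.Im (p (t + s) - p t - d * s%:C).
  by case: (p (t + s)) (p t) (d) => [? ?] [? ?] [? ?] /=; ring.
split=> [[/is_deriveP Hr /is_deriveP Hi] e e0|H].
  have e2 : 0 < e / 2 by lra.
  have [k k0 hr] := Hr _ e2; have [l l0 hi] := Hi _ e2.
  exists (Num.min k l) => [|s]; first by rewrite lt_min k0.
  rewrite lt_min => /andP[/hr r1 /hi r2].
  apply: le_trans (nm_le_ReIm _) _.
  by rewrite -ReE -ImE; lra.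
split; apply/is_deriveP => e /H[k k0 Hk]; exists k => // s /Hk.
  by rewrite ReE; apply: le_trans; exact: Re_le_nm.
by rewrite ImE; apply: le_trans; exact: Im_le_nm.
Qed.

Lemma pderiv_comp f z w t d : cderiv f (z + t%:C * w) d ->
  pderiv (fun s => f (z + s%:C * w)) t (d * w).
Proof.
move=> fd; apply/pderivP => e e0.
have w1 : 0 < nm w + 1 by have := nm_ge0 w; lra.
have [k k0 H] := fd (e / (nm w + 1)) (divr_gt0 e0 w1).
exists (k / (nm w + 1)) => [|s]; first exact: divr_gt0.
rewrite ltr_pdivlMr // => sk.
have nsw : nm (s%:C * w) <= `|s| * (nm w + 1).
  by rewrite nmM nmR; apply: ler_wpM2l => //; lra.
have := H (s%:C * w) (le_lt_trans nsw sk).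
have -> : z + t%:C * w + s%:C * w = z + (t + s)%:C * w by rewrite rmorphD /=; ring.
have -> : d * (s%:C * w) = d * w * s%:C by ring.
move=> /le_trans; apply.
have -> : e * `|s| = e / (nm w + 1) * (`|s| * (nm w + 1)) by field; rewrite gt_eqF.
by rewrite ler_wpM2l // divr_ge0 // ltW.
Qed.

Lemma is_derive_mvt g (g' : R -> R) a b : a <= b ->
  (forall t, is_derive t (1 : R) g (g' t)) ->
  exists2 c, a <= c <= b & g b - g a = g' c * (b - a).
Proof.
move=> ab gd; have [|c] := @MVT_segment _ g g' a b ab (fun t _ => gd t).
  apply: derivable_within_continuous => x _.
  exact: (@ex_derive _ _ _ _ _ _ _ (gd x)).
by rewrite in_itv /= => cab e; exists c.
Qed.

(** The real mean value theorem is applied to the real and imaginary parts separately, at different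
    points: hence the factor 2. *)
Lemma pderiv_mvt p (p' : R -> C) a b (M : R) : a <= b ->
  (forall t, pderiv p t (p' t)) ->
  (forall t, a <= t <= b -> nm (p' t) <= M) ->
  nm (p b - p a) <= 2 * M * (b - a).
Proof.
move=> ab pd pM.
have [c1 /pM c1M e1] := is_derive_mvt ab (fun t => (pd t).1).
have [c2 /pM c2M e2] := is_derive_mvt ab (fun t => (pd t).2).
apply: le_trans (nm_le_ReIm _) _.
have -> : complex.Re (p b - p a) = complex.Re (p b) - complex.Re (p a).
  by case: (p b) (p a) => [? ?] [? ?].
have -> : complex.Im (p b - p a) = complex.Im (p b) - complex.Im (p a).
  by case: (p b) (p a) => [? ?] [? ?].
rewrite e1 e2 !normrM (@ger0_norm _ (b - a)) ?subr_ge0 //.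
have b0 : 0 <= b - a by rewrite subr_ge0.
rewrite -mulrDl ler_wpM2r //.
by have := Re_le_nm (p' c1); have := Im_le_nm (p' c2); lra.
Qed.

(** Removable singularity of a difference quotient, given a second derivative [D] at [z]. The
    second-order Taylor remainder has derivative o(|v - z|), so the mean value inequality on a
    segment makes it o(|h|^2), and division by [h] leaves o(|h|). It will give the simple zero of
    [1 - ec u]. *)
Lemma cderiv_dq f (f1 : C -> C) z D :
  (forall u, cderiv f u (f1 u)) -> cderiv f1 z D ->
  forall u, holo (fun v => if v == z then f1 z else (f v - f z) / (v - z)) u.
Proof.
move=> fd f1d u; have [->|uz] := eqVneq u z; last first.
  apply: (@holo_ext _ (fun v => (f v - f z) / (v - z)) _ _ (nm (u - z))).
  - by rewrite nm_gt0 subr_eq0.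
  - by move=> v; case: eqVneq => // ->; rewrite nmBC ltxx.
  - apply: holoM; first by apply: holoB; [exists (f1 u) | exact: holo_cst].
    apply: holo_inv; first by rewrite subr_eq0.
    by apply: holoB; [exact: holo_id | exact: holo_cst].
exists (D / 2) => e e0; have e2 : 0 < e / 2 by lra.
have [k k0 H] := f1d _ e2; exists k => // h hk.
rewrite eqxx; have [/eqP h0|h0] := eqVneq (z + h) z.
  rewrite -subr_eq0 addrC addKr in h0.
  by rewrite (eqP h0) subrr mulr0 subrr nm0 mulr0.
have {}h0 : h != 0 by apply: contra_neq h0 => ->; rewrite addr0.
pose F v := f v - f z - f1 z * (v - z) - D / 2 * (v - z) ^+ 2.
have Fd v : cderiv F v (f1 v - f1 z - D * (v - z)).
  have sd : cderiv (fun v => v - z) v 1.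
    by have := cderivD (cderiv_id v) (cderiv_cst (- z) v); rewrite addr0.
  have A1 := cderivD (fd v) (cderiv_cst (- f z) v).
  have A2 := cderivM (cderiv_cst (- f1 z) v) sd.
  have A3 := cderivM (cderiv_cst (- (D / 2)) v) (cderivM sd sd).
  have := cderivD (cderivD A1 A2) A3.
  have -> : f1 v + 0 + (0 * (v - z) + - f1 z * 1) +
     (0 * ((v - z) * (v - z)) + - (D / 2) * (1 * (v - z) + (v - z) * 1))
     = f1 v - f1 z - D * (v - z) by field.
  by apply: (@cderiv_ext _ _ _ _ _ 1) => // x _; rewrite /F; ring.
have := @pderiv_mvt _ _ 0 1 (e / 2 * nm h ^+ 2) ler01
   (fun t => pderiv_comp (Fd (z + t%:C * h))).
have -> : z + 1%:C * h = z + h by rewrite mul1r.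
have -> : z + 0%:C * h = z by rewrite mul0r addr0.
move=> Q.
have {Q} : nm (F (z + h) - F z) <= 2 * (e / 2 * nm h ^+ 2) * (1 - 0).
  apply: Q => t /andP[t0 t1].
  have th : nm (t%:C * h) <= nm h.
    by rewrite nmM nmR ger0_norm // ler_piMl // nm_ge0.
  have -> : z + t%:C * h - z = t%:C * h by ring.
  rewrite nmM expr2 [leRHS]mulrA ler_wpM2r ?nm_ge0 //.
  apply: le_trans (H _ (le_lt_trans th hk)) _.
  by rewrite ler_wpM2l // ltW.
have -> : F (z + h) - F z = (((f (z + h) - f z) / (z + h - z) - f1 z - D / 2 * h) * h).
  have -> : z + h - z = h by ring.
  by rewrite /F; field.
have -> : 2 * (e / 2 * nm h ^+ 2) * (1 - 0) = e * nm h * nm h by field.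
by rewrite nmM ler_pM2r // nm_gt0.
Qed.

End PathDerivative.

(** * The complex exponential and its periods *)

Section Exponential.
Variable R : realType.
Local Notation C := R[i].
Implicit Types (z w : C).

Lemma cexpD z w : cexp (z + w) = cexp z * cexp w.
Proof.
case: z w => [a b] [c d]; rewrite /cexp /= expRD cosD sinD.
by apply/eqP; rewrite eq_complex /=; apply/andP; split; apply/eqP; ring.
Qed.

Lemma cexp0 : cexp 0 = 1 :> C.
Proof. by rewrite /cexp /= expR0 cos0 sin0 mul1r. Qed.

Lemma nm_cexp z : nm (cexp z) = expR (complex.Re z).
Proof.
rewrite /cexp nmM nmR ger0_norm ?expR_ge0 //.
by rewrite /nm /= cos2Dsin2 sqrtr1 mulr1.
Qed.

Lemma cderiv_cexp0 : cderiv (@cexp R) 0 1.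
Proof.
(* The three error terms below are at most [e1], [2 * e1] and [3 * e1] times [nm h], in total
   [6 * e1]; the bound [e1 <= 1] is what gives the 3 in [T2]. *)
move=> e e0; pose e1 := Num.min (e / 6) 1.
have e10 : 0 < e1 by rewrite /e1 lt_min ltr01 andbT; lra.
have e16 : e1 <= e / 6 by rewrite /e1 ge_min lexx.
have e11 : e1 <= 1 by rewrite /e1 ge_min lexx orbT.
clearbody e1.
have [k1 k10 H1] := (is_deriveP _ _ _).1 (is_derive_expR (0 : R)) _ e10.
have [k2 k20 H2] := (is_deriveP _ _ _).1 (is_derive_cos (0 : R)) _ e10.
have [k3 k30 H3] := (is_deriveP _ _ _).1 (is_derive_sin (0 : R)) _ e10.
exists (Num.min e1 (Num.min k1 (Num.min k2 k3))) => [|h].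
  by rewrite !lt_min k10 k20 k30 e10.
rewrite !lt_min => /and4P[h0 h1 h2 h3].
have xr := Re_le_nm h; have yr := Im_le_nm h.
have {H1 h1} := H1 _ (le_lt_trans xr h1).
have {H2 h2} := H2 _ (le_lt_trans yr h2).
have {H3 h3} := H3 _ (le_lt_trans yr h3).
rewrite !add0r expR0 cos0 sin0 subr0 oppr0 mul0r subr0 !mul1r.
rewrite cexp0 /cexp.
set x := complex.Re h; set y := complex.Im h => s1 c1 x1.
have -> : h = x%:C + (0 +i* y).
  by rewrite /x /y; case: (h) => ? ?; apply/eqP; rewrite eq_complex /= add0r addr0 !eqxx.
set T := cos y +i* sin y; set E := (expR x)%:C.
have T1 : nm (T - 1 - (0 +i* y)) <= 2 * e1 * nm h.
  apply: le_trans (nm_le_ReIm _) _; rewrite /T /= subr0 subr0.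
  have : e1 * `|y| <= e1 * nm h by rewrite ler_wpM2l // ltW.
  lra.
have T0 : nm T = 1 by rewrite /nm /= cos2Dsin2 sqrtr1.
have T2 : nm (T - 1) <= 3 * nm h.
  have -> : T - 1 = (T - 1 - (0 +i* y)) + (0 +i* y) by rewrite subrK.
  apply: le_trans (nmD _ _) _.
  have : nm (0 +i* y) <= nm h.
    by apply: le_trans (nm_le_ReIm _) _; rewrite /= normr0 add0r.
  by have := nm_ge0 h; nra.
have E1 : nm (E - 1 - x%:C) <= e1 * nm h.
  have -> : E - 1 - x%:C = (expR x - 1 - x)%:C by rewrite !rmorphB.
  rewrite nmR (le_trans x1) // ler_wpM2l //; exact: ltW.
have -> : E * T - 1 - (x%:C + (0 +i* y)) =
  (E - 1 - x%:C) * T + (T - 1 - (0 +i* y)) + x%:C * (T - 1) by ring.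
have X : nm (x%:C * (T - 1)) <= e1 * (3 * nm h).
  rewrite nmM nmR ler_pM ?nm_ge0 //.
  by apply: le_trans xr _; exact: ltW.
apply: le_trans (nmD _ _) _; apply: le_trans (lerD (nmD _ _) X) _.
rewrite nmM T0 mulr1.
have -> : x%:C + (0 +i* y) = h.
  by rewrite /x /y; case: (h) => ? ?; apply/eqP; rewrite eq_complex /= add0r addr0 !eqxx.
have : e1 * nm h <= e / 6 * nm h by rewrite ler_wpM2r // nm_ge0.
lra.
Qed.

Lemma cderiv_cexp z : cderiv (@cexp R) z (cexp z).
Proof.
have A1 : cderiv (fun u => u - z) z 1.
  by have := cderivD (cderiv_id z) (cderiv_cst (- z) z); rewrite addr0.
have A2 : cderiv (@cexp R) (z - z) 1 by rewrite subrr; exact: cderiv_cexp0.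
have := cderivM (cderiv_cst (cexp z) z) (@cderiv_comp _ (@cexp R) (fun u => u - z) _ _ _ A2 A1).
rewrite mul0r add0r mulr1 mulr1.
by apply: (@cderiv_ext _ _ _ _ _ 1) => // u _; rewrite -cexpD addrC subrK.
Qed.

(* [2 i pi], spelled as in [same_quasi_periodicity] *)
Definition twopii : C := 2 * pi%:C * 'i.

Lemma twopiiE : twopii = 0 +i* (2 * pi).
Proof.
rewrite /twopii -complexiE; apply/eqP; rewrite eq_complex /=.
by apply/andP; split; apply/eqP; ring.
Qed.

Definition ec z : C := cexp (twopii * z).

Lemma ecD z w : ec (z + w) = ec z * ec w.
Proof. by rewrite /ec mulrDr cexpD. Qed.

Lemma ec0 : ec 0 = 1.
Proof. by rewrite /ec mulr0 cexp0. Qed.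

Lemma nm_ec z : nm (ec z) = expR (- (2 * pi * complex.Im z)).
Proof.
rewrite /ec nm_cexp twopiiE; congr expR.
by case: z => a b /=; ring.
Qed.

Lemma ec_neq0 z : ec z != 0.
Proof. by rewrite -nm_gt0 nm_ec expR_gt0. Qed.

Lemma ecN z : ec (- z) = (ec z)^-1.
Proof. by apply: (mulIf (ec_neq0 z)); rewrite mulVf ?ec_neq0 // -ecD addNr ec0. Qed.

Lemma ecX z k : ec z ^+ k = ec (k%:R * z).
Proof.
elim: k => [|k IH]; first by rewrite mul0r ec0.
by rewrite exprS IH -ecD -[in RHS]natr1 mulrDl mul1r addrC.
Qed.

Lemma ec1 : ec 1 = 1.
Proof.
rewrite /ec mulr1 twopiiE /cexp /= expR0 mul1r.
by rewrite mulr_natl cos2pi sin2pi.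
Qed.

Lemma ec_int (k : int) : ec k%:~R = 1.
Proof.
have H (j : nat) : ec j%:R = 1.
  by have := ecX 1 j; rewrite mulr1 => <-; rewrite ec1 expr1n.
by case: k => j; rewrite ?NegzE ?mulrNz ?ecN H ?invr1.
Qed.

(** The modulus forces [z] to be real. For its fractional part [t], cos(2 pi t) = 1 means sin(pi t)
    = 0, while the sine is positive on the open interval from 0 to pi. *)
Lemma ec_eq1 z : ec z = 1 -> exists k : int, z = k%:~R.
Proof.
move=> e1.
have Im0 : complex.Im z = 0.
  have := nm_ec z; rewrite e1 nm1 -(expR0 R) => /expR_inj /esym /eqP.
  rewrite oppr_eq0 mulf_eq0 => /orP[|/eqP //].
  by rewrite gt_eqF // mulr_gt0 ?pi_gt0.
set k := Num.floor (complex.Re z); exists k.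
have /andP[kz zk] := floor_itv (complex.Re z).
set t := complex.Re z - k%:~R.
have t0 : 0 <= t by rewrite /t subr_ge0.
have t1 : t < 1 by rewrite /t ltrBlDl -[1]/(1%:~R) -intrD.
have zE : z = t%:C + k%:~R.
  rewrite -(rmorph_int (real_complex R)) -rmorphD /t subrK.
  by move: Im0; case: (z) => a b /= ->.
have : ec t%:C = 1 by move: e1; rewrite zE ecD ec_int mulr1.
rewrite /ec twopiiE /cexp /=.
have -> : 0 * t - 2 * pi * 0 = 0 :> R by ring.
have -> : 0 * 0 + 2 * pi * t = (pi * t) *+ 2 :> R by rewrite -mulr_natl; ring.
rewrite expR0 mul1r => -[+ _]; rewrite cos_mulr2n cos2sin2 => c1.
have /eqP : sin (pi * t) ^+ 2 = 0 by rewrite mulr2n in c1; lra.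
rewrite expf_eq0 /= => /eqP s0.
have [t00|tn] := eqVneq t 0; first by rewrite zE t00 add0r.
have : 0 < sin (pi * t).
  have t0' : 0 < t by rewrite lt_def tn.
  by apply: sin_gt0_pi; rewrite mulr_gt0 ?pi_gt0 //= gtr_pMr ?pi_gt0.
by rewrite s0 ltxx.
Qed.

Lemma cderiv_ec z : cderiv ec z (twopii * ec z).
Proof.
have A := cderivM (cderiv_cst twopii z) (cderiv_id z).
rewrite mul0r add0r mulr1 in A.
by rewrite mulrC; apply: cderiv_comp A; exact: cderiv_cexp.
Qed.

Lemma holo_ec z : holo ec z.
Proof. by exists (twopii * ec z); exact: cderiv_ec. Qed.

End Exponential.

(** * Primitives and the theorem of Goursat *)

Section PathIntegral.
Variable R : realType.
Local Notation C := R[i].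
Implicit Types (z w c : C) (f : C -> C) (p q P Q : R -> C) (g : R -> R) (t a b : R).

Lemma cont_primitive_on g (n : R) : 0 < n -> continuous g ->
  exists G : R -> R, forall t, - n < t < n -> is_derive t (1 : R) G (g t).
Proof.
move=> n0 gc; exists (fun x => \int[lebesgue_measure]_(t in `[- n, x]) g t)%R.
move=> t /andP[nt tn].
have ig : lebesgue_measure.-integrable `[- n, n] (EFin \o g).
  apply: continuous_compact_integrable; first exact: segment_compact.
  exact: continuous_subspaceT.
have [|dF Fg] := @continuous_FTC1 R g (BLeft (- n)) t n tn ig _ (gc t).
  by rewrite lte_fin.
by split=> //; rewrite -Fg derive1E.
Qed.

(** Primitives on the intervals ]-(n+1), n+1[ agree once normalized to vanish at 0, since their
    differences have zero derivative; they are glued with an index depending on [t]. *)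
Lemma cont_primitive g : continuous g ->
  exists G : R -> R, forall t, is_derive t (1 : R) G (g t).
Proof.
move=> gc.
have /choice[F HF] (n : nat) := cont_primitive_on (ltr0Sn R n) gc.
pose bnd (t : R) := Num.truncn `|t|.
have bndP t (n : nat) : (bnd t <= n)%N -> - n.+1%:R < t < n.+1%:R.
  move=> bn; rewrite -ltr_norml; apply: lt_le_trans (truncnS_gt _) _.
  by rewrite ler_nat.
have cmp (m n : nat) t : (bnd t <= m)%N -> (m <= n)%N ->
    F m t - F m 0 = F n t - F n 0.
  move=> tm mn; apply/eqP; rewrite -subr_eq0; apply/eqP.
  have inm s : `|s| <= `|t| -> - m.+1%:R < s < m.+1%:R /\ - n.+1%:R < s < n.+1%:R.
    move=> st; have sm : (bnd s <= m)%N.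
      by apply: leq_trans tm; rewrite le_truncn.
    by split; apply: bndP => //; exact: leq_trans mn.
  pose H s := F m s - F n s.
  have Hd s : `|s| <= `|t| -> is_derive s (1 : R) H 0.
    move=> /inm[sm sn]; rewrite -(subrr (g s)); apply: is_deriveB; exact: HF.
  have HE a b : a <= b -> `|a| <= `|t| -> `|b| <= `|t| -> H a = H b.
    move=> ab at_ bt_.
    have Hab s : a <= s <= b -> `|s| <= `|t|.
      move: at_ bt_; rewrite !ler_norml => /andP[A1 _] /andP[_ A2] /andP[A3 A4].
      by rewrite (le_trans A1 A3) (le_trans A4 A2).
    have [| |s _] := @MVT_segment _ H (fun=> 0) a b ab; last first.
    - by rewrite mul0r => /eqP; rewrite subr_eq0 => /eqP.
    - apply: derivable_within_continuous => x; rewrite in_itv /= => /Hab /Hd dx.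
      exact: (@ex_derive _ _ _ _ _ _ _ dx).
    - move=> x; rewrite in_itv /= => /andP[ax xb]; apply: Hd; apply: Hab.
      by rewrite !ltW.
  have : H 0 = H t.
    have [t0|t0] := leP 0 t; first by apply: HE; rewrite ?normr0.
    by apply/esym; apply: HE; rewrite ?normr0 // ltW.
  by rewrite /H; lra.
exists (fun t => F (bnd t) t - F (bnd t) 0) => t.
(* One more than [bnd t], so that the same primitive serves at [t + s] for all [|s| < 1]. *)
pose n := (bnd t).+1.
apply/is_deriveP => e e0.
have tn : (bnd t <= n)%N by rewrite /n.
have /is_deriveP /(_ e e0) [k k0 Hk] := HF n t (bndP t n tn).
exists (Num.min k 1) => [|s]; first by rewrite lt_min k0 ltr01.
rewrite lt_min => /andP[/Hk sk s1].
have tsn : (bnd (t + s)%R <= n)%N.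
  have : `|t + s| < n.+1%:R.
    apply: le_lt_trans (ler_normD _ _) _; rewrite -natr1.
    by apply: ltrD => //; exact: truncnS_gt.
  by rewrite /bnd -truncn_lt_nat.
rewrite (cmp _ n (t + s)) // (cmp _ n t) //.
by have -> : F n (t + s) - F n 0 - (F n t - F n 0) - g t * s =
  F n (t + s) - F n t - g t * s by ring.
Qed.

Definition pcont p := forall t (e : R), 0 < e ->
  exists2 k : R, 0 < k & forall s, `|s| < k -> nm (p (t + s) - p t) < e.

Definition primitive p P := forall t, pderiv P t (p t).

Lemma pcont_primitive p : pcont p -> exists P, primitive p P.
Proof.
move=> pc.
have aux (h : C -> R) : (forall z, `|h z| <= nm z) ->
    (forall z w, h (z - w) = h z - h w) -> continuous (h \o p).
  move=> h1 hB t; apply/cvgrPdist_lt => e e0.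
  have [k k0 H] := pc t e e0.
  apply/nbhs_ballP; exists k => //= s; rewrite /ball /= distrC => sk.
  rewrite distrC -hB; apply: le_lt_trans (h1 _) _.
  by have := H _ sk; rewrite [t + _]addrC subrK.
have [|F HF] := @cont_primitive (@complex.Re R \o p).
- by apply: aux; [exact: Re_le_nm | case=> [? ?] [? ?]].
have [|G HG] := @cont_primitive (@complex.Im R \o p).
- by apply: aux; [exact: Im_le_nm | case=> [? ?] [? ?]].
by exists (fun t => F t +i* G t) => t; split => /=; [exact: HF | exact: HG].
Qed.

Lemma primitive_cst P : primitive (fun=> 0) P -> forall s t, P s = P t.
Proof.
move=> P0 s t; apply/eqP; rewrite eq_complex; apply/andP; split; apply/eqP.
  by apply: (@is_derive_0_is_cst R (fun s => complex.Re (P s))) => x; have [] := P0 x.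
by apply: (@is_derive_0_is_cst R (fun s => complex.Im (P s))) => x; have [] := P0 x.
Qed.

Lemma primitiveD p q P Q : primitive p P -> primitive q Q ->
  primitive (fun t => p t + q t) (fun t => P t + Q t).
Proof.
move=> pP qQ t; apply/pderivP => e e0; have e2 : 0 < e / 2 by lra.
have /pderivP /(_ _ e2) [k k0 Hk] := pP t.
have /pderivP /(_ _ e2) [l l0 Hl] := qQ t.
exists (Num.min k l) => [|s]; first by rewrite lt_min k0.
rewrite lt_min => /andP[/Hk H1 /Hl H2].
have -> : P (t + s) + Q (t + s) - (P t + Q t) - (p t + q t) * s%:C =
  (P (t + s) - P t - p t * s%:C) + (Q (t + s) - Q t - q t * s%:C) by ring.
by apply: le_trans (nmD _ _) _; lra.
Qed.

Lemma primitiveZ c p P : primitive p P ->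
  primitive (fun t => c * p t) (fun t => c * P t).
Proof.
move=> pP t; apply/pderivP => e e0.
have c0 : 0 < nm c + 1 by have := nm_ge0 c; lra.
have /pderivP /(_ _ (divr_gt0 e0 c0)) [k k0 Hk] := pP t.
exists k => // s /Hk H.
have -> : c * P (t + s) - c * P t - c * p t * s%:C =
  c * (P (t + s) - P t - p t * s%:C) by ring.
rewrite nmM; apply: le_trans (_ : (nm c + 1) * (e / (nm c + 1) * `|s|) <= _).
  by rewrite ler_pM ?nm_ge0 // lerDl.
by have -> : (nm c + 1) * (e / (nm c + 1) * `|s|) = e * `|s| by field; rewrite gt_eqF.
Qed.

Lemma primitive_shift p P a : primitive p P ->
  primitive (fun t => p (t + a)) (fun t => P (t + a)).
Proof.
move=> pP t; apply/pderivP => e e0.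
have /pderivP /(_ _ e0) [k k0 Hk] := pP (t + a).
by exists k => // s /Hk; rewrite [t + s + a]addrAC.
Qed.

(* Only meaningful when [p] has a primitive; otherwise the default is [0]. *)
Definition cint p a b :=
  let P := xget (fun=> 0) [set P | primitive p P] in P b - P a.

Lemma cintE p P a b : primitive p P -> cint p a b = P b - P a.
Proof.
move=> pP; rewrite /cint; case: xgetP => [Q _ /= qQ|]; last by move/(_ P).
have := primitiveD qQ (primitiveZ (-1) pP).
have -> : (fun t => p t + -1 * p t) = (fun=> 0).
  by apply/funext => t; rewrite mulN1r subrr.
move=> /primitive_cst /(_ b) /= E.
apply/eqP; rewrite -subr_eq0; apply/eqP.
have -> : Q b - Q a - (P b - P a) = Q b + -1 * P b - (Q a + -1 * P a) by ring.
by rewrite (E a) subrr.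
Qed.

Lemma cintD p q a b : pcont p -> pcont q ->
  cint (fun t => p t + q t) a b = cint p a b + cint q a b.
Proof.
move=> /pcont_primitive[P pP] /pcont_primitive[Q qQ].
by rewrite (cintE _ _ (primitiveD pP qQ)) (cintE _ _ pP) (cintE _ _ qQ); ring.
Qed.

Lemma cintZ c p a b : pcont p -> cint (fun t => c * p t) a b = c * cint p a b.
Proof.
move=> /pcont_primitive[P pP].
by rewrite (cintE _ _ (primitiveZ c pP)) (cintE _ _ pP) mulrBr.
Qed.

Lemma cint_split b p a s : pcont p -> cint p a s = cint p a b + cint p b s.
Proof. by move=> /pcont_primitive[P pP]; rewrite !(cintE _ _ pP); ring. Qed.

Lemma cint_shift p a b s : pcont p ->
  cint (fun t => p (t + s)) a b = cint p (a + s) (b + s).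
Proof.
by move=> /pcont_primitive[P pP]; rewrite (cintE _ _ (primitive_shift s pP)) (cintE _ _ pP).
Qed.

Lemma cint_le p a b (M : R) : pcont p -> a <= b ->
  (forall t, a <= t <= b -> nm (p t) <= M) -> nm (cint p a b) <= 2 * M * (b - a).
Proof.
move=> /pcont_primitive[P pP] ab pM.
by rewrite (cintE _ _ pP); exact: pderiv_mvt pP pM.
Qed.

(** For a primitive [P], the function [P (t + 1) - P t] has zero derivative. *)
Lemma cint_period p a : pcont p -> (forall t, p (t + 1) = p t) ->
  cint p a (a + 1) = cint p 0 1.
Proof.
move=> /pcont_primitive[P pP] p1; rewrite !(cintE _ _ pP).
have := primitiveD (primitive_shift 1 pP) (primitiveZ (-1) pP).
have -> : (fun t => p (t + 1) + -1 * p t) = (fun=> 0).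
  by apply/funext => t; rewrite p1 mulN1r subrr.
move=> /primitive_cst /(_ a 0) /=; rewrite !mulN1r add0r.
exact.
Qed.

Lemma holo_pcont f z w : (forall u, holo f u) -> pcont (fun t => f (z + t%:C * w)).
Proof.
move=> fh t e e0; have [d fd] := fh (z + t%:C * w).
have [k k0 H] := cderiv_cont fd e0.
have w1 : 0 < nm w + 1 by have := nm_ge0 w; lra.
exists (k / (nm w + 1)) => [|s]; first exact: divr_gt0.
rewrite ltr_pdivlMr // => sk; apply: H.
have -> : z + (t + s)%:C * w - (z + t%:C * w) = s%:C * w by rewrite rmorphD /=; ring.
by rewrite nmM nmR; apply: le_lt_trans sk; rewrite ler_wpM2l // lerDl.
Qed.

End PathIntegral.

(** * Goursat's theorem on rectangles and shifts of contour *)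

Section Goursat.
Variable R : realType.
Local Notation C := R[i].
Implicit Types (z w c : C) (f g : C -> C) (x y : R).

(** The integral of [f] along the boundary of a rectangle, counterclockwise; on the vertical sides
    dz = i dt. *)
Definition rect f x1 x2 y1 y2 : C :=
  cint (fun t => f (t +i* y1)) x1 x2 - cint (fun t => f (t +i* y2)) x1 x2
  + (0 +i* 1) * (cint (fun t => f (x2 +i* t)) y1 y2 - cint (fun t => f (x1 +i* t)) y1 y2).

Lemma horE x y : x +i* y = (0 +i* y) + x%:C * 1.
Proof. by apply/eqP; rewrite mulr1 eq_complex /= add0r addr0 !eqxx. Qed.

Lemma verE x y : x +i* y = x%:C + y%:C * (0 +i* 1).
Proof. by apply/eqP; rewrite eq_complex /=; apply/andP; split; apply/eqP; ring. Qed.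

Lemma hor_pcont f y : (forall u, holo f u) -> pcont (fun t => f (t +i* y)).
Proof.
move=> /(holo_pcont (0 +i* y) 1); congr pcont; apply/funext => t.
by rewrite -horE.
Qed.

Lemma ver_pcont f x : (forall u, holo f u) -> pcont (fun t => f (x +i* t)).
Proof.
move=> /(holo_pcont x%:C (0 +i* 1)); congr pcont; apply/funext => t.
by rewrite -verE.
Qed.

Lemma rectD f g x1 x2 y1 y2 : (forall u, holo f u) -> (forall u, holo g u) ->
  rect (fun u => f u + g u) x1 x2 y1 y2 = rect f x1 x2 y1 y2 + rect g x1 x2 y1 y2.
Proof.
move=> fh gh; rewrite /rect.
by rewrite !cintD; [ring | first [exact: hor_pcont | exact: ver_pcont] ..].
Qed.

Lemma rect_split f x1 x2 y1 y2 x y : (forall u, holo f u) ->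
  rect f x1 x2 y1 y2 =
    rect f x1 x y1 y + rect f x x2 y1 y + rect f x1 x y y2 + rect f x x2 y y2.
Proof.
move=> fh; have h := hor_pcont _ fh; have v := ver_pcont _ fh; rewrite /rect.
rewrite (cint_split x x1 x2 (h y1)) (cint_split x x1 x2 (h y2)).
by rewrite (cint_split y y1 y2 (v x1)) (cint_split y y1 y2 (v x2)); ring.
Qed.

Lemma rect_primitive f g x1 x2 y1 y2 :
  (forall u, cderiv g u (f u)) -> (forall u, holo f u) -> rect f x1 x2 y1 y2 = 0.
Proof.
move=> gf fh.
have hP y : primitive (fun t => f (t +i* y)) (fun t => g (t +i* y)).
  move=> t; have := @pderiv_comp _ g (0 +i* y) 1 t (f (t +i* y)).
  rewrite -horE mulr1 => /(_ (gf _)).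
  by congr (pderiv _ _ _); apply/funext => s; rewrite -horE.
have vP x : primitive (fun t => f (x +i* t) * (0 +i* 1)) (fun t => g (x +i* t)).
  move=> t; have := @pderiv_comp _ g x%:C (0 +i* 1) t (f (x +i* t)).
  rewrite -verE => /(_ (gf _)).
  by congr (pderiv _ _ _); apply/funext => s; rewrite -verE.
have vE x a b : (0 +i* 1) * cint (fun t => f (x +i* t)) a b = g (x +i* b) - g (x +i* a).
  have fc : pcont (fun t => f (x +i* t)) by exact: ver_pcont.
  rewrite -cintZ // -(cintE _ _ (vP x)).
  by congr cint; apply/funext => s; rewrite mulrC.
by rewrite /rect mulrBr !vE !(cintE _ _ (hP _)); ring.
Qed.

Lemma nested_intervals (X : nat -> R * R) : (forall n, (X n).1 <= (X n).2) ->
  (forall n, (X n).1 <= (X n.+1).1) -> (forall n, (X n.+1).2 <= (X n).2) ->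
  exists p, forall n, (X n).1 <= p <= (X n).2.
Proof.
move=> le inc dec.
have mono1 n k : (X n).1 <= (X (n + k)%N).1.
  elim: k => [|k IH]; first by rewrite addn0.
  by rewrite addnS (le_trans IH).
have mono2 n k : (X (n + k)%N).2 <= (X n).2.
  elim: k => [|k IH]; first by rewrite addn0.
  by rewrite addnS (le_trans _ IH).
have cross n m : (X n).1 <= (X m).2.
  apply: le_trans (mono1 n m) _; apply: le_trans (le _) _.
  by rewrite addnC mono2.
pose S := range (fun n => (X n).1).
have S0 : S !=set0 by exists (X 0%N).1, 0%N.
exists (sup S) => n; apply/andP; split.
  apply: ub_le_sup; last by exists n.
  by exists (X 0%N).2 => _ [m _ <-].
by apply: ge_sup => // _ [m _ <-].
Qed.

Let half (b : bool) (s : R * R) :=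
  let m := (s.1 + s.2) / 2 in if b then (s.1, m) else (m, s.2).

Lemma bisection (X : nat -> R * R) : (X 0%N).1 <= (X 0%N).2 ->
  (forall n, exists b, X n.+1 = half b (X n)) ->
  exists p, forall n, (X n).1 <= p <= (X n).2 /\
    (X n).2 - (X n).1 = ((X 0%N).2 - (X 0%N).1) / 2 ^+ n.
Proof.
move=> X0 Xh.
have len n : (X n).2 - (X n).1 = ((X 0%N).2 - (X 0%N).1) / 2 ^+ n.
  elim: n => [|n IH]; first by rewrite expr0 divr1.
  have := exprn_gt0 n (ltr0Sn R 1) => p2.
  rewrite exprS invfM mulrCA -IH.
  by have [b ->] := Xh n; rewrite /half; case: b => /=; lra.
have le n : (X n).1 <= (X n).2.
  by rewrite -subr_ge0 len divr_ge0 ?subr_ge0 // exprn_ge0.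
have [||p Hp] := nested_intervals le.
- by move=> n; have [b ->] := Xh n; have := le n; rewrite /half; case: b => /=; lra.
- by move=> n; have [b ->] := Xh n; have := le n; rewrite /half; case: b => /=; lra.
by exists p.
Qed.

Lemma pow2_gt (L k : R) : 0 < k -> exists n, L / 2 ^+ n < k.
Proof.
move=> k0; exists (Num.truncn (L / k)).+1.
rewrite ltr_pdivrMr ?exprn_gt0 // mulrC -ltr_pdivrMr //.
apply: lt_trans (truncnS_gt _) _.
by rewrite -natrX ltr_nat ltn_expl.
Qed.

(** Repeated quartering: some quarter carries at least a fourth of the integral. Near the common
    point [p] of the nested rectangles, [f] is affine up to an error [e * nm (u - p)], and the
    affine part has a primitive. The factor 4^n is compensated by the square of the size, which
    decreases as 4^(-n). *)
Lemma goursat f x1 x2 y1 y2 : (forall u, holo f u) -> x1 <= x2 -> y1 <= y2 ->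
  rect f x1 x2 y1 y2 = 0.
Proof.
move=> fh x12 y12.
pose rQ (Q : (R * R) * (R * R)) := rect f Q.1.1 Q.1.2 Q.2.1 Q.2.2.
have step Q : exists b : bool * bool,
    nm (rQ Q) <= 4 * nm (rQ (half b.1 Q.1, half b.2 Q.2)).
  apply: contrapT => /forallNP H.
  have {}H (b c : bool) : 4 * nm (rQ (half b Q.1, half c Q.2)) < nm (rQ Q).
    by have /negP := H (b, c); rewrite -ltNge.
  have := rect_split Q.1.1 Q.1.2 Q.2.1 Q.2.2
    ((Q.1.1 + Q.1.2) / 2) ((Q.2.1 + Q.2.2) / 2) fh.
  have := H true true; have := H true false; have := H false true.
  have := H false false; rewrite /rQ /half /=.
  set a := rect _ _ _ _ _; set b := rect _ _ _ _ _; set c := rect _ _ _ _ _.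
  set d := rect _ _ _ _ _; set e := rect _ _ _ _ _ => h1 h2 h3 h4 E.
  have := nmD (e + c + d) a; have := nmD (e + c) d; have := nmD e c.
  rewrite -E; lra.
have [B HB] := choice step.
pose Q n := iter n (fun Q => (half (B Q).1 Q.1, half (B Q).2 Q.2)) ((x1, x2), (y1, y2)).
have Qn n : nm (rQ (Q 0%N)) <= 4 ^+ n * nm (rQ (Q n)).
  elim: n => [|n IH]; first by rewrite mul1r.
  apply: le_trans IH _; by rewrite exprSr -mulrA ler_wpM2l ?exprn_ge0.
have [||px Hx] := @bisection (fun n => (Q n).1) => //.
  by move=> n; exists (B (Q n)).1.
have [||py Hy] := @bisection (fun n => (Q n).2) => //.
  by move=> n; exists (B (Q n)).2.
set L := (x2 - x1) + (y2 - y1).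
have L0 : 0 <= L by rewrite /L; lra.
(* The constant 8 is four sides times the factor 2 of [cint_le]. *)
suff small e : 0 < e -> nm (rQ (Q 0%N)) <= 8 * e * L ^+ 2.
  apply/eqP; rewrite -nm_eq0 eq_le nm_ge0 andbT.
  apply/ler_addgt0Pr => e e0; rewrite add0r.
  have L1 : 0 < 8 * L ^+ 2 + 1 by have := sqr_ge0 L; lra.
  apply: le_trans (small _ (divr_gt0 e0 L1)) _.
  have -> : 8 * (e / (8 * L ^+ 2 + 1)) * L ^+ 2 = e * ((8 * L ^+ 2) / (8 * L ^+ 2 + 1)).
    by field; rewrite gt_eqF.
  by rewrite ler_piMr ?ltW // ltr_pdivrMr // mul1r ltrDl.
move=> e0; pose p : C := px +i* py.
have [d fd] := fh p; have [k k0 Hk] := fd _ e0.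
have [n Ln] := pow2_gt L k0.
apply: le_trans (Qn n) _.
have [/andP[X1 X2] Xl] := Hx n; have [/andP[Y1 Y2] Yl] := Hy n.
rewrite /= in Xl Yl.
pose r u := f u + (- f p - d * (u - p)).
have ah u : holo (fun u => - f p - d * (u - p)) u.
  apply: holoB; first exact: holo_cst.
  by apply: holoM; [exact: holo_cst | apply: holoB; [exact: holo_id|exact: holo_cst]].
have rh u : holo r u by apply: holoD.
have rE : rQ (Q n) = rect r (Q n).1.1 (Q n).1.2 (Q n).2.1 (Q n).2.2.
  rewrite rectD // (@rect_primitive (fun u => - f p - d * (u - p))
    (fun u => (- f p + d * p) * u - d / 2 * (u * u))) //.
    by rewrite addr0.
  move=> u.
  have A1 := cderivM (cderiv_cst (- f p + d * p) u) (cderiv_id u).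
  have A2 := cderivM (cderiv_cst (- (d / 2)) u) (cderivM (cderiv_id u) (cderiv_id u)).
  have := cderivD A1 A2.
  have -> : 0 * id u + (- f p + d * p) * 1 + (0 * (id u * id u) + - (d / 2) * (1 * id u + id u * 1))
     = - f p - d * (u - p) by rewrite /=; field.
  by apply: (@cderiv_ext _ _ _ _ _ 1) => // v _ /=; ring.
set l := L / 2 ^+ n in Ln.
have l0 : 0 <= l by rewrite divr_ge0 // exprn_ge0.
have lE : ((Q n).1.2 - (Q n).1.1) + ((Q n).2.2 - (Q n).2.1) = l.
  by rewrite Xl Yl -mulrDl.
have rl s t : (Q n).1.1 <= s <= (Q n).1.2 -> (Q n).2.1 <= t <= (Q n).2.2 ->
    nm (r (s +i* t)) <= e * l.
  move=> /andP[s1 s2] /andP[t1 t2]; rewrite /r.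
  have h : nm ((s +i* t) - p) <= l.
    apply: le_trans (nm_le_ReIm _) _; rewrite /p /= -lE.
    by apply: lerD; rewrite ler_norml; apply/andP; split; lra.
  have := Hk _ (le_lt_trans h Ln); rewrite [p + _]addrC subrK.
  rewrite addrA => /le_trans; apply.
  by rewrite ler_wpM2l // ltW.
have bnd (q : R -> C) s t : pcont q -> s <= t -> t - s <= l ->
   (forall x, s <= x <= t -> nm (q x) <= e * l) -> nm (cint q s t) <= 2 * e * l ^+ 2.
  move=> qc st tsl ql; apply: le_trans (cint_le qc st ql) _.
  have -> : 2 * e * l ^+ 2 = 2 * (e * l) * l by ring.
  apply: ler_wpM2l => //.
  by rewrite !mulr_ge0 // ltW.
have X12 := le_trans X1 X2; have Y12 := le_trans Y1 Y2.
have lx : (Q n).1.2 - (Q n).1.1 <= l by rewrite -lE lerDl subr_ge0.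
have ly : (Q n).2.2 - (Q n).2.1 <= l by rewrite -lE lerDr subr_ge0.
have : nm (rQ (Q n)) <= 8 * e * l ^+ 2.
  rewrite rE /rect; apply: le_trans (nmD _ _) _; rewrite nmM nmi mul1r.
  apply: le_trans (lerD (nmB _ _) (nmB _ _)) _.
  have B1 := bnd _ _ _ (hor_pcont (Q n).2.1 rh) X12 lx.
  have B2 := bnd _ _ _ (hor_pcont (Q n).2.2 rh) X12 lx.
  have B3 := bnd _ _ _ (ver_pcont (Q n).1.2 rh) Y12 ly.
  have B4 := bnd _ _ _ (ver_pcont (Q n).1.1 rh) Y12 ly.
  apply: le_trans (lerD (lerD (B1 _) (B2 _)) (lerD (B3 _) (B4 _))) _;
    try (by move=> x hx; apply: rl; rewrite ?hx ?lexx ?X12 ?Y12).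
  lra.
have p4 : 0 <= 4 ^+ n :> R by rewrite exprn_ge0.
move=> /(ler_wpM2l p4) /le_trans; apply.
rewrite le_eqVlt; apply/orP; left; apply/eqP.
have -> : 4 = 2 ^+ 2 :> R by ring.
rewrite /l -exprM mulnC exprM; field.
by rewrite expf_neq0 // pnatr_eq0.
Qed.

(** Horizontally this is invariance under translation over a period; vertically it is [goursat] on a
    rectangle of width 1, whose vertical sides cancel by periodicity. *)
Lemma cint_period_cst f z : (forall u, holo f u) -> (forall u, f (u + 1) = f u) ->
  cint (fun t => f (t%:C + z)) 0 1 = cint (fun t => f t%:C) 0 1.
Proof.
move=> fh f1; case: z => x y.
have -> : (fun t => f (t%:C + (x +i* y))) = (fun t => f ((t + x) +i* y)).
  by apply/funext => t; congr f; apply/eqP; rewrite eq_complex /= add0r !eqxx.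
have fE (t s : R) : f ((t + 1) +i* s) = f (t +i* s).
  rewrite -[RHS]f1; congr f; apply/eqP.
  by rewrite eq_complex /= addr0 !eqxx.
have hc := hor_pcont _ fh.
rewrite (cint_shift 0 1 x (hc y)) add0r [1 + x]addrC cint_period //.
have H (y1 y2 : R) : y1 <= y2 ->
    cint (fun t => f (t +i* y1)) 0 1 = cint (fun t => f (t +i* y2)) 0 1.
  move=> y12; have := goursat fh (@ler01 R) y12; rewrite /rect.
  have -> : (fun t => f (1 +i* t)) = (fun t => f (0 +i* t)).
    by apply/funext => t; rewrite -(fE 0) add0r.
  by rewrite subrr mulr0 addr0 => /eqP; rewrite subr_eq0 => /eqP.
by have [y0|/ltW y0] := leP 0 y; [rewrite -(H _ _ y0) | rewrite (H _ _ y0)].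
Qed.

End Goursat.

(** * Fourier coefficients and quasi-periodic functions *)

Section Fourier.
Variable R : realType.
Local Notation C := R[i].
Implicit Types (z w c : C) (f g q : C -> C) (t : R) (k : int).

Definition entireH f := forall u, holo f u.

Lemma line_pcont f : entireH f -> pcont (fun t => f t%:C).
Proof. exact: hor_pcont. Qed.

Lemma line_bounded f (a b : R) : entireH f -> exists2 M : R, 0 < M &
  forall t, a <= t <= b -> nm (f t%:C) <= M.
Proof.
move=> fh; have pc := line_pcont fh.
have nc : continuous (fun t => nm (f t%:C)).
  move=> t; apply/cvgrPdist_lt => e e0; have [k k0 H] := pc t e e0.
  apply/nbhs_ballP; exists k => //= s; rewrite /ball /= distrC => sk.
  have := H _ sk; rewrite [t + _]addrC subrK; apply: le_lt_trans.
  set x := f t%:C; set y := f s%:C.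
  have := nmD (y - x) x; have := nmB (y - x) y.
  rewrite subrK [y - x - y]addrAC subrr add0r nmN => h1 h2.
  by rewrite ler_norml; apply/andP; split; lra.
have [ab|ba] := leP a b; last first.
  by exists 1 => // t /andP[h1 h2]; have := lt_le_trans ba (le_trans h1 h2); rewrite ltxx.
have [|c _ H] := @EVT_max R (fun t => nm (f t%:C)) a b ab.
  exact: continuous_subspaceT.
exists (nm (f c%:C) + 1); first by have := nm_ge0 (f c%:C); lra.
by move=> t tab; have := H t; rewrite in_itv /= => /(_ tab); lra.
Qed.

Lemma entire_ecZ c : entireH (fun z => ec (c * z)).
Proof.
by move=> z; apply: holo_comp; [exact: holo_ec | apply: holoM; [exact: holo_cst|exact: holo_id]].
Qed.

(** On the real line this is cos(pi t)^2; written with [ec], multiplication by it only mixes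
    neighbouring Fourier indices. *)
Definition peak z : C := 2^-1 + 4^-1 * (ec z + ec (- z)).

Lemma peakE t : peak t%:C = (cos (pi * t) ^+ 2)%:C.
Proof.
have E (s : R) : ec s%:C = cos (2 * pi * s) +i* sin (2 * pi * s).
  rewrite /ec twopiiE /cexp /=.
  have -> : 0 * s - 2 * pi * 0 = 0 :> R by ring.
  by rewrite expR0 mul1r mul0r add0r.
have -> : peak t%:C = 2^-1 + 4^-1 * (ec t%:C + ec (- t)%:C) by rewrite /peak rmorphN.
rewrite !E.
have -> : 2 * pi * - t = - ((pi * t) *+ 2) by rewrite -mulr_natl; ring.
have -> : 2 * pi * t = (pi * t) *+ 2 by rewrite -mulr_natl; ring.
rewrite cosN sinN cos_mulr2n.
have -> : 2^-1 = (2^-1 : R)%:C by rewrite fmorphV rmorph_nat.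
have -> : 4^-1 = (4^-1 : R)%:C by rewrite fmorphV rmorph_nat.
by apply/eqP; rewrite eq_complex /=; apply/andP; split; apply/eqP; field.
Qed.

Lemma entire_peakX m : entireH (fun z => peak z ^+ m).
Proof.
move=> z; apply: holoX; apply: holoD; first exact: holo_cst.
apply: holoM; first exact: holo_cst.
apply: holoD; first exact: holo_ec.
apply: holo_comp; first exact: holo_ec.
by apply: holoN; exact: holo_id.
Qed.

Lemma entireM f g : entireH f -> entireH g -> entireH (fun z => f z * g z).
Proof. by move=> fh gh z; exact: holoM. Qed.

Lemma bernoulli_pow (x : R) m : 0 <= x -> 1 + m%:R * x <= (1 + x) ^+ m.
Proof.
move=> x0; elim: m => [|m IH]; first by rewrite mul0r addr0.
rewrite exprS -natr1; have : 0 <= m%:R * x ^+ 2 by rewrite mulr_ge0 ?sqr_ge0.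
have : (1 + x) * (1 + m%:R * x) <= (1 + x) * (1 + x) ^+ m.
  by rewrite ler_wpM2l // addr_ge0.
by nra.
Qed.

(** One factor [peak] turns the coefficient at [k] into a combination of those at [k], [k + 1] and
    [k - 1], so the vanishing of all of them persists by induction. *)
Lemma peak_orthogonal q : entireH q -> 
  (forall k, cint (fun t => q t%:C * ec (k%:~R * t%:C)) 0 1 = 0) ->
  forall m k, cint (fun t => q t%:C * peak t%:C ^+ m * ec (k%:~R * t%:C)) 0 1 = 0.
Proof.
move=> qh q0; elim=> [|m IH] k.
  rewrite -[RHS](q0 k); congr cint; apply/funext => t.
  by rewrite expr0 mulr1.
pose F c j z := c * (q z * peak z ^+ m * ec (j%:~R * z)).
have Fh c j : entireH (F c j).
  apply: entireM; first by move=> ?; exact: holo_cst.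
  apply: entireM; last exact: entire_ecZ.
  by apply: entireM => //; exact: entire_peakX.
have H j : pcont (fun t => q t%:C * peak t%:C ^+ m * ec (j%:~R * t%:C)).
  have := line_pcont (Fh 1 j); congr pcont; apply/funext => t.
  by rewrite /F mul1r.
have HZ c j : pcont (fun t => c * (q t%:C * peak t%:C ^+ m * ec (j%:~R * t%:C))).
  exact: (line_pcont (Fh c j)).
have HZ2 c j c' j' : pcont (fun t => c * (q t%:C * peak t%:C ^+ m * ec (j%:~R * t%:C))
    + c' * (q t%:C * peak t%:C ^+ m * ec (j'%:~R * t%:C))).
  apply: (@line_pcont (fun z => F c j z + F c' j' z)) => z.
  by apply: holoD; exact: Fh.
pose e j t := q t%:C * peak t%:C ^+ m * ec (j%:~R * t%:C).
have -> : (fun t => q t%:C * peak t%:C ^+ m.+1 * ec (k%:~R * t%:C)) =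
   (fun t => (2^-1 * e k t + 4^-1 * e (k + 1) t) + 4^-1 * e (k - 1) t).
  apply/funext => t; rewrite /e exprS.
  have -> : (k + 1)%:~R * t%:C = k%:~R * t%:C + t%:C :> C by rewrite rmorphD /=; ring.
  have -> : (k - 1)%:~R * t%:C = k%:~R * t%:C + - t%:C :> C by rewrite rmorphB /=; ring.
  by rewrite !ecD /peak; ring.
rewrite /e (cintD _ _ (HZ2 _ _ _ _) (HZ _ _)) (cintD _ _ (HZ _ _) (HZ _ _)).
by rewrite !(cintZ _ _ _ (H _)) !IH !mulr0 !addr0.
Qed.

(** The period from -1/2 to 1/2 is cut at the points with [|t| = dl / 2] and [|t| = dl]. The middle
    piece has length [dl] and contributes at least [B * dl], its two neighbours at least 0, and the
    outer pieces, of total length below 1, at least [- A]. *)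
Lemma peak_estimate (G G' : R -> R) (dl A B : R) :
  0 < dl -> dl <= 4^-1 -> 0 <= A ->
  (forall t, is_derive t (1 : R) G (G' t)) ->
  (forall t, `|t| <= dl -> 0 <= G' t) -> (forall t, `|t| <= dl / 2 -> B <= G' t) ->
  (forall t, dl <= `|t| <= 2^-1 -> - A <= G' t) ->
  B * dl <= A + (G 2^-1 - G (- 2^-1)).
Proof.
move=> dl0 dl4 A0 Gd Gin Gmid Gout.
have incr (a b m : R) : a <= b -> (forall t, a <= t <= b -> m <= G' t) ->
    m * (b - a) <= G b - G a.
  move=> ab H; have [c cab ->] := is_derive_mvt ab Gd.
  by rewrite ler_wpM2r ?subr_ge0 // H.
have u1 : - A * (- dl - - 2^-1) <= G (- dl) - G (- 2^-1).
  by apply: incr => [|t /andP[? ?]]; [lra | apply: Gout; rewrite ler0_norm; lra].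
have u5 : - A * (2^-1 - dl) <= G 2^-1 - G dl.
  by apply: incr => [|t /andP[? ?]]; [lra | apply: Gout; rewrite ger0_norm; lra].
have u2 : 0 * (- (dl / 2) - - dl) <= G (- (dl / 2)) - G (- dl).
  by apply: incr => [|t /andP[? ?]]; [lra | apply: Gin; rewrite ler0_norm; lra].
have u4 : 0 * (dl - dl / 2) <= G dl - G (dl / 2).
  by apply: incr => [|t /andP[? ?]]; [lra | apply: Gin; rewrite ger0_norm; lra].
have u3 : B * (dl / 2 - - (dl / 2)) <= G (dl / 2) - G (- (dl / 2)).
  by apply: incr => [|t ?]; [lra | apply: Gmid; rewrite ler_norml].
have := mulr_ge0 A0 (ltW dl0).
have -> : B * dl = B * (dl / 2 - - (dl / 2)) by field.
by lra.
Qed.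

(* The weights [peak ^+ m] are nonnegative trigonometric polynomials that
   concentrate at the integers as [m] grows. *)
Lemma fourier_peak q : entireH q -> (forall z, q (z + 1) = q z) -> q 0 = 1 ->
  ~ (forall k, cint (fun t => q t%:C * ec (k%:~R * t%:C)) 0 1 = 0).
Proof.
move=> qh q1 q01 q0.
have [M M0 HM] := line_bounded (- 2^-1) 2^-1 qh.
have h2 : 0 < 2^-1 :> R by lra.
have [k k0 Hk] := line_pcont qh 0 h2.
pose dl := Num.min (k / 2) (4^-1 : R).
have dl0 : 0 < dl by rewrite lt_min divr_gt0 //=; lra.
have dlk : dl < k by apply: le_lt_trans (_ : k / 2 < k); [rewrite ge_min lexx | lra].
have dl4 : dl <= 4^-1 by rewrite ge_min lexx orbT.
clearbody dl.
have qRe s : - dl <= s <= dl -> 2^-1 <= complex.Re (q s%:C).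
  move=> sd; have : `|s| < k by apply: le_lt_trans dlk; rewrite ler_norml.
  move=> /Hk; rewrite add0r q01 => /ltW.
  move=> /(le_trans (Re_le_nm _)).
  have -> : complex.Re (q s%:C - 1) = complex.Re (q s%:C) - 1 by case: (q s%:C).
  by rewrite ler_norml => /andP[? _]; lra.
(* [t1] bounds the peak from below for [|t| <= dl / 2], [t2] bounds it from above for
   [dl <= |t| <= 1/2]. *)
pose t1 := cos (pi * (dl / 2)) ^+ 2 : R; pose t2 := cos (pi * dl) ^+ 2 : R.
have p0 := pi_gt0 R.
have cosle (x y : R) : 0 <= x <= y -> y <= 2^-1 -> 0 <= cos (pi * y) <= cos (pi * x).
  move=> /andP[x0 xy] y2; apply/andP; split.
    apply: cos_ge0_pihalf; apply/andP; split; nra.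
  move: xy; rewrite le_eqVlt => /predU1P[-> //|xy]; apply/ltW.
  by rewrite ltr_cos ?in_itv /= ?ltr_pM2l //; apply/andP; split; nra.
have sqle (x y : R) : 0 <= x <= y -> y <= 2^-1 -> cos (pi * y) ^+ 2 <= cos (pi * x) ^+ 2.
  by move=> xy /(cosle _ _ xy) /andP[? ?]; rewrite !expr2 ler_pM.
have cosabs (x : R) : cos (pi * x) = cos (pi * `|x|) .
  by rewrite -[LHS]cos_norm normrM (ger0_norm (ltW p0)).
have t20 : 0 < t2.
  rewrite exprn_gt0 //; apply: cos_gt0_pihalf; apply/andP; split; nra.
have t12 : t2 < t1.
  rewrite /t1 /t2 !expr2.
  have : cos (pi * dl) < cos (pi * (dl / 2)).
    by rewrite ltr_cos ?in_itv /= ?ltr_pM2l //; try (apply/andP; split); nra.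
  have /andP[c0 _] : 0 <= cos (pi * dl) <= cos (pi * dl).
    by apply: cosle; [rewrite lexx ltW|lra].
  by nra.
(* The weighted integral over a period centred at the peak vanishes, so the mass near 0, where the
   real part of [q] is at least 1/2, is bounded by the mass far from 0. *)
have main m : dl / 2 * t1 ^+ m <= M * t2 ^+ m.
  have := peak_orthogonal qh q0 m 0.
  have -> : (fun t => q t%:C * peak t%:C ^+ m * ec (0%:~R * t%:C)) =
            (fun t => q t%:C * peak t%:C ^+ m).
    by apply/funext => t; rewrite mulr0z mul0r ec0 mulr1.
  have Fh : entireH (fun z => q z * peak z ^+ m).
    by apply: entireM => //; exact: entire_peakX.
  have Fc := line_pcont Fh.
  have peak1 z : peak (z + 1) = peak z by rewrite /peak opprD !ecD (ecN 1) ec1 invr1 !mulr1.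
  have per t : q (t + 1)%:C * peak (t + 1)%:C ^+ m = q t%:C * peak t%:C ^+ m.
    by rewrite rmorphD /= q1 peak1.
  move=> E; have := etrans (cint_period (- 2^-1) Fc per) E; move=> {E}.
  have [P HP] := pcont_primitive Fc.
  rewrite (cintE _ _ HP) => /(congr1 (@complex.Re R)).
  have -> : - 2^-1 + 1 = 2^-1 :> R by field.
  pose G t := complex.Re (P t).
  have -> : complex.Re (P 2^-1 - P (- 2^-1)) = G 2^-1 - G (- 2^-1).
    by rewrite /G; case: (P _) (P _) => [? ?] [? ?].
  move=> /= G0; rewrite -[leRHS]addr0 -G0.
  pose T t : R := (cos (pi * t) ^+ 2) ^+ m.
  have T0 t : 0 <= T t by rewrite exprn_ge0 ?sqr_ge0.
  have -> : dl / 2 * t1 ^+ m = (2^-1 * t1 ^+ m) * dl by ring.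
  apply: (@peak_estimate G (fun t => complex.Re (q t%:C) * T t)) => //.
  - by apply: mulr_ge0; [exact: ltW|apply: exprn_ge0; exact: ltW].
  - move=> t; have [+ _] := HP t; rewrite peakE -rmorphXn /=.
    have -> : complex.Re (q t%:C * (T t)%:C) = complex.Re (q t%:C) * T t.
      by case: (q t%:C) => a b /=; ring.
    by [].
  - move=> t tdl; apply: mulr_ge0 => //; apply: le_trans (ltW h2) (qRe _ _).
    by rewrite -ler_norml.
  - move=> t td; apply: ler_pM.
    + exact: ltW.
    + by apply: exprn_ge0; exact: sqr_ge0.
    + apply: qRe; rewrite -ler_norml; apply: le_trans td _.
      by rewrite ler_pdivrMr // ler_peMr ?ler1n // ltW.
    + rewrite /T cosabs; apply: lerXn2r; rewrite ?nnegrE ?sqr_ge0 //.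
      by apply: sqle; [rewrite normr_ge0 | move: dl0 dl4; clear; lra].
  - move=> t /andP[td t2']; have tM : nm (q t%:C) <= M by apply: HM; rewrite -ler_norml.
    have T2 : T t <= t2 ^+ m.
      rewrite /T cosabs; apply: lerXn2r; rewrite ?nnegrE ?sqr_ge0 //.
      by apply: sqle; rewrite ?td ?(ltW dl0).
    have := le_trans (Re_le_nm (q t%:C)) tM; rewrite ler_norml => /andP[qM _].
    apply: le_trans (_ : - M * T t <= _); last by rewrite ler_wpM2r.
    by rewrite mulNr lerN2 ler_wpM2l // ltW.
(* As [t1 > t2], Bernoulli's inequality makes [(t1 / t2) ^+ m] exceed any bound, against [main]. *)
pose x := t1 / t2 - 1.
have x0 : 0 < x by rewrite /x subr_gt0 ltr_pdivlMr // mul1r.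
pose m := (Num.truncn (M / (dl / 2) / x)).+1.
have d2 : 0 < dl / 2 by lra.
have : M / (dl / 2) < 1 + m%:R * x.
  have := truncnS_gt (M / (dl / 2) / x); rewrite -/m ltr_pdivrMr //; lra.
move=> /lt_le_trans /(_ (bernoulli_pow m (ltW x0))).
have -> : 1 + x = t1 / t2 by rewrite /x addrC subrK.
rewrite expr_div_n ltNge => /negP; apply.
have t2m : 0 < t2 ^+ m by apply: exprn_gt0.
by rewrite ler_pdivrMr // mulrAC ler_pdivlMr // mulrC.
Qed.

Lemma entire_comp f g : entireH f -> entireH g -> entireH (fun z => f (g z)).
Proof. by move=> fh gh z; apply: holo_comp. Qed.

Lemma entire_shift f w : entireH f -> entireH (fun z => f (z + w)).
Proof.
move=> fh; apply: entire_comp => // z.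
by apply: holoD; [exact: holo_id | exact: holo_cst].
Qed.

Definition fcoef g k := cint (fun t => g t%:C * ec (- (k%:~R * t%:C))) 0 1.

Lemma entire_fcoef g k : entireH g -> entireH (fun z => g z * ec (- (k%:~R * z))).
Proof.
move=> gh; apply: entireM => //.
have := entire_ecZ (- k%:~R); congr entireH; apply/funext => z.
by rewrite mulNr.
Qed.

Lemma fcoef_shift g k z : entireH g -> (forall u, g (u + 1) = g u) ->
  cint (fun t => g (t%:C + z) * ec (- (k%:~R * (t%:C + z)))) 0 1 = fcoef g k.
Proof.
move=> gh g1; have := cint_period_cst z (entire_fcoef k gh); apply => u.
by rewrite g1 mulrDr mulr1 opprD ecD (ecN k%:~R) ec_int invr1 mulr1.
Qed.

(** If [g z != 0], translate [z] to the origin and divide by [g z]. Moving the contour back to the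
    real line shows that each coefficient of the new function is a multiple of one of [g], so all of
    them vanish, against [fourier_peak]. *)
Lemma fourier_inj g : entireH g -> (forall u, g (u + 1) = g u) ->
  (forall k, fcoef g k = 0) -> forall z, g z = 0.
Proof.
move=> gh g1 g0 z; apply: contrapT => /eqP gz.
pose q u := (g z)^-1 * g (u + z).
have qh : entireH q.
  by apply: entireM; [move=> ?; exact: holo_cst | exact: entire_shift].
apply: (@fourier_peak q) => //.
- by move=> u; rewrite /q addrAC g1.
- by rewrite /q add0r mulVf.
move=> k.
have gc : pcont (fun t => g (t%:C + z) * ec (- ((- k)%:~R * (t%:C + z)))).
  exact: (line_pcont (entire_shift z (entire_fcoef (- k) gh))).
have -> : (fun t => q t%:C * ec (k%:~R * t%:C)) = fun t => ((g z)^-1 * ec (- (k%:~R * z)))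
    * (g (t%:C + z) * ec (- ((- k)%:~R * (t%:C + z)))).
  apply/funext => t; rewrite /q.
  have -> : k%:~R * t%:C = - (k%:~R * z) + - ((- k)%:~R * (t%:C + z)) :> C.
    by rewrite rmorphN /=; ring.
  by rewrite ecD; ring.
by rewrite cintZ // fcoef_shift // g0 mulr0.
Qed.

Lemma fcoef_bounded g : entireH g -> exists M, forall k, nm (fcoef g k) <= M.
Proof.
move=> gh; have [M M0 HM] := line_bounded 0 1 gh; exists (2 * M * (1 - 0)) => k.
apply: (cint_le (line_pcont (entire_fcoef k gh))) => // t t01.
rewrite nmM nm_ec.
have -> : complex.Im (- (k%:~R * t%:C)) = 0.
  rewrite -(rmorph_int (real_complex R)) -rmorphM -rmorphN //.
by rewrite mulr0 oppr0 expR0 mulr1 HM.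
Qed.

Lemma fcoefD g h k : entireH g -> entireH h ->
  fcoef (fun z => g z + h z) k = fcoef g k + fcoef h k.
Proof.
move=> gh hh; rewrite /fcoef -cintD; try exact: line_pcont (entire_fcoef k _).
by congr cint; apply/funext => t; rewrite mulrDl.
Qed.

Lemma fcoefZ c g k : entireH g -> fcoef (fun z => c * g z) k = c * fcoef g k.
Proof.
move=> gh; rewrite /fcoef -cintZ; last exact: line_pcont (entire_fcoef k _).
by congr cint; apply/funext => t; rewrite mulrA.
Qed.

Lemma fcoef_sum (I : Type) (r : seq I) (g : I -> C -> C) (c : I -> C) k :
  (forall i, entireH (g i)) ->
  fcoef (fun z => \sum_(i <- r) c i * g i z) k = \sum_(i <- r) c i * fcoef (g i) k.
Proof.
move=> gh; elim: r => [|i r IH].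
  rewrite big_nil -[RHS](mul0r (fcoef (fun=> 0) k)).
  rewrite -(@fcoefZ 0 (fun=> 0)) ; last by move=> u; exact: holo_cst.
  by congr fcoef; apply/funext => z; rewrite big_nil mul0r.
have -> : (fun z => \sum_(j <- i :: r) c j * g j z) =
    (fun z => c i * g i z + \sum_(j <- r) c j * g j z).
  by apply/funext => z; rewrite big_cons.
rewrite big_cons fcoefD ?fcoefZ ?IH //.
  by apply: entireM => // u; exact: holo_cst.
move=> u; elim: r {IH} => [|j r IH].
  apply: (@holo_ext _ (fun=> 0) _ _ 1) => //; last exact: holo_cst.
  by move=> z _; rewrite big_nil.
apply: (@holo_ext _ (fun z => c j * g j z + \sum_(i <- r) c i * g i z) _ _ 1) => //.
  by move=> z _; rewrite big_cons.
by apply: holoD => //; apply: holoM; [exact: holo_cst | exact: gh].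
Qed.

End Fourier.

(** * The recurrence for the Fourier coefficients and its three cases *)

Section QuasiPeriodic.
Variable R : realType.
Local Notation C := R[i].
Variable tau : C.
Hypothesis tau_gt0 : 0 < complex.Im tau.
Implicit Types (z w c s : C) (f g h : C -> C) (k N : int).

(** Theta functions of degree [N]; with this sign, [N] will be the number of zeros modulo the
    lattice. *)
Definition qper N s g := [/\ entireH g, forall u, g (u + 1) = g u &
  forall u, g (u + tau) = g u * ec (- (N%:~R * u) - s)].

(** The coefficient is computed once on the real line and once on the line through [tau], where the
    multiplier shifts the index by [N]. *)
Lemma fcoef_rec N s g k : qper N s g ->
  fcoef g (k + N) = ec (s + k%:~R * tau) * fcoef g k.
Proof.
move=> [gh g1 gt]; rewrite -(fcoef_shift k tau gh g1) /fcoef.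
have -> : (fun t : R => g (t%:C + tau) * ec (- (k%:~R * (t%:C + tau)))) =
  (fun t : R => ec (- (s + k%:~R * tau)) * (g t%:C * ec (- ((k + N)%:~R * t%:C)))).
  apply/funext => t; rewrite gt -mulrA -ecD [RHS]mulrCA -ecD; congr (_ * ec _).
  by rewrite rmorphD /=; ring.
rewrite cintZ; last exact: line_pcont (entire_fcoef _ gh).
by rewrite mulrA ecN mulfV ?ec_neq0 // mul1r.
Qed.

Lemma fcoef_eq0_rec N s g k : qper N s g -> (fcoef g (k + N) == 0) = (fcoef g k == 0).
Proof. by move=> /fcoef_rec ->; rewrite mulf_eq0 (negPf (ec_neq0 _)). Qed.

(** Along [k], [k + N], [k + 2 N], ..., the ratios of successive moduli grow exponentially, whereas
    coefficients are bounded. So one of them is 0, and the recurrence carries this back to [k]. *)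
Lemma qper_neg N s g : N < 0 -> qper N s g -> forall z, g z = 0.
Proof.
move=> N0 gq; have [gh g1 _] := gq; apply: fourier_inj => // k.
pose b (j : nat) := fcoef g (k + N * j%:Z).
have bS j : b j.+1 = fcoef g (k + N * j%:Z + N).
  by rewrite /b intS mulrDr mulr1 [N + _]addrC addrA.
suff [j bj] : exists j, b j = 0.
  elim: j bj => [|j IH]; first by rewrite /b mulr0 addr0.
  by rewrite bS => /eqP; rewrite (fcoef_eq0_rec _ gq) => /eqP.
have [M HM] := fcoef_bounded gh.
have p0 := pi_gt0 R.
pose A := 2 * pi * complex.Im (s + k%:~R * tau).
pose B := 2 * pi * complex.Im tau.
have B0 : 0 < B by rewrite !mulr_gt0.
have nmbS j : nm (b j.+1) = expR (- A + (- N%:~R) * j%:R * B) * nm (b j).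
  rewrite bS (fcoef_rec _ gq) nmM nm_ec; congr (expR _ * _).
  rewrite /A /B rmorphD rmorphM /= -(rmorph_int (real_complex R) N).
  rewrite -pmulrn -(rmorph_nat (real_complex R) j) -(rmorph_int (real_complex R) k).
  by case: (s) (tau) => [a1 a2] [a3 a4] /=; ring.
have N1 : 1 <= - N%:~R :> R.
  by rewrite -rmorphN /= ler1z; lia.
(* From index [J] on the exponent in [nmbS] is at least 1, so the ratio is at least 2 because
   [expR x >= 1 + x]. *)
pose J := (Num.truncn ((1 + `|A|) / B)).+1.
have grow j : 2 * nm (b (J + j)%N) <= nm (b (J + j).+1).
  rewrite nmbS ler_wpM2r ?nm_ge0 //.
  apply: le_trans (expR_ge1Dx _); rewrite lerD2l -[leLHS]opprK.
  have := truncnS_gt ((1 + `|A|) / B); rewrite -/J ltr_pdivrMr // => hJ.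
  have h2 : J%:R * B <= - N%:~R * (J + j)%:R * B.
    rewrite ler_wpM2r ?(ltW B0) //; apply: le_trans (_ : (J + j)%:R <= _).
      by rewrite ler_nat leq_addr.
    by rewrite ler_peMl.
  by have := ler_norm A; lra.
have grow2 j : 2 ^+ j * nm (b J) <= nm (b (J + j)%N).
  elim: j => [|j IH]; first by rewrite mul1r addn0.
  rewrite addnS; apply: le_trans (grow j); rewrite exprS -mulrA.
  by rewrite ler_wpM2l.
exists J; apply/eqP/negPn/negP; rewrite -nm_gt0 => bJ.
have [n] := pow2_gt M bJ; rewrite ltr_pdivrMr ?exprn_gt0 // mulrC.
by move=> /lt_le_trans /(_ (le_trans (grow2 n) (HM _))); rewrite ltxx.
Qed.

(** Now the recurrence relates a coefficient to itself: at a nonzero one, [ec (s + k%:~R * tau)]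
    must be 1. *)
Lemma qper_zero s g z : qper 0 s g -> g z != 0 ->
  exists k l : int, s = k%:~R + l%:~R * tau.
Proof.
move=> gq gz; have [gh g1 _] := gq.
have [k fk] : exists k, fcoef g k != 0.
  apply: contrapT => /forallNP H; case/eqP: gz; apply: fourier_inj => // k.
  by apply/eqP/negPn/negP; exact: H.
have := fcoef_rec k gq; rewrite addr0 => /esym/eqP.
rewrite -[eqbRHS]mul1r (inj_eq (mulIf fk)) => /eqP /ec_eq1[l sl].
exists l, (- k); rewrite -sl rmorphN /=; ring.
Qed.

Lemma qper_coef_inj (n : nat) s g : qper n.+1%:Z s g ->
  (forall i : 'I_n.+1, fcoef g i%:Z = 0) -> forall z, g z = 0.
Proof.
move=> gq g0; have [gh g1 _] := gq; apply: fourier_inj => // k.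
have H (j : nat) m : (fcoef g (m + j%:Z * n.+1%:Z) == 0) = (fcoef g m == 0).
  elim: j => [|j IH]; first by rewrite mul0r addr0.
  by rewrite intS mulrDl mul1r [_ + j%:Z * _]addrC addrA (fcoef_eq0_rec _ gq).
have r0 : 0 <= (k %% n.+1%:Z)%Z by rewrite modz_ge0.
have rn : (k %% n.+1%:Z)%Z < n.+1%:Z by rewrite ltz_pmod.
have fr : fcoef g (k %% n.+1%:Z)%Z = 0.
  move: r0 rn; case: (k %% n.+1%:Z)%Z => // r _ rn.
  exact: (g0 (Ordinal (rn : (r < n.+1)%N))).
apply/eqP; have kE := divz_eq k n.+1%:Z.
have [q0|q0] := leP 0 (k %/ n.+1%:Z)%Z.
  move: (k %/ n.+1%:Z)%Z (k %% n.+1%:Z)%Z q0 kE fr {r0 rn} => [] // d r _ -> fr.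
  by rewrite addrC (H d r) fr.
(* [H] only moves indices upwards, so for a negative quotient it is applied at [k] to reach the
   remainder. *)
rewrite -(H `|(k %/ n.+1%:Z)%Z|%N k) abszE ltr0_norm //.
have -> : k + - (k %/ n.+1%:Z)%Z * n.+1%:Z = (k %% n.+1%:Z)%Z.
  by rewrite {1}kE mulNr addrAC subrr add0r.
by rewrite fr.
Qed.

End QuasiPeriodic.

(** * Euler's function *)

Section PowerSeries.
Variable R : realType.
Local Notation C := R[i].
Implicit Types (z w h l : C) (S a : nat -> C).

Definition cconv S l := forall e : R, 0 < e ->
  exists n0, forall n, (n0 <= n)%N -> nm (S n - l) <= e.

Lemma cconv_uniq S l l' : cconv S l -> cconv S l' -> l = l'.
Proof.
move=> Sl Sl'; apply/eqP; rewrite -subr_eq0 -nm_eq0 eq_le nm_ge0 andbT.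
apply/ler_addgt0Pr => e e0; rewrite add0r; have e2 : 0 < e / 2 by lra.
have [n Hn] := Sl _ e2; have [m Hm] := Sl' _ e2.
have := Hn _ (leq_maxl n m); have := Hm _ (leq_maxr n m).
set x := S _; have := nmB (x - l') (x - l).
have -> : x - l' - (x - l) = l - l' by ring.
lra.
Qed.

Lemma cconvD S S' l l' : cconv S l -> cconv S' l' -> cconv (fun n => S n + S' n) (l + l').
Proof.
move=> Sl Sl' e e0; have e2 : 0 < e / 2 by lra.
have [n Hn] := Sl _ e2; have [m Hm] := Sl' _ e2.
exists (maxn n m) => k; rewrite geq_max => /andP[/Hn h1 /Hm h2].
have -> : S k + S' k - (l + l') = (S k - l) + (S' k - l') by ring.
by have := nmD (S k - l) (S' k - l'); lra.
Qed.

Lemma cconvZ c S l : cconv S l -> cconv (fun n => c * S n) (c * l).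
Proof.
move=> Sl e e0; have c0 : 0 < nm c + 1 by have := nm_ge0 c; lra.
have [n Hn] := Sl _ (divr_gt0 e0 c0); exists n => k /Hn; rewrite -mulrBr nmM => H.
apply: le_trans (_ : (nm c + 1) * (e / (nm c + 1)) <= _).
  by rewrite ler_pM ?nm_ge0 // lerDl.
by rewrite mulrC divfK // gt_eqF.
Qed.

Lemma cconv_le S l (M : R) : cconv S l -> (forall n, nm (S n) <= M) -> nm l <= M.
Proof.
move=> Sl SM; apply/ler_addgt0Pr => e /Sl[n /(_ _ (leqnn n))].
have := nmB (S n) (S n - l); rewrite opprB addrC subrK.
by have := SM n; lra.
Qed.

Lemma real_geom_lim (u : nat -> R) (K : R) : 0 <= K ->
  (forall n, `|u n.+1 - u n| <= K / 2 ^+ n) ->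
  exists l : R, forall n, `|u n - l| <= 2 * K / 2 ^+ n.
Proof.
(* The radius shrinks by [K / 2 ^+ n.+1 * 2 = K / 2 ^+ n] at step [n], as much as the centre may
   move, so the intervals are nested. *)
move=> K0 uK; pose X n := (u n - 2 * K / 2 ^+ n, u n + 2 * K / 2 ^+ n).
have p n : 0 <= 2 * K / 2 ^+ n by rewrite divr_ge0 ?mulr_ge0 // exprn_ge0.
have pS n : 2 * K / 2 ^+ n.+1 = K / 2 ^+ n.
  by rewrite exprS; field; rewrite expf_neq0 // pnatr_eq0.
have pE n : 2 * K / 2 ^+ n = 2 * (K / 2 ^+ n) by rewrite mulrA.
have [|||l Hl] := @nested_intervals _ X => [n|n|n|].
- by rewrite /X /=; have := p n; lra.
- by rewrite /X /= pS pE; have := uK n; rewrite ler_norml => /andP[]; lra.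
- by rewrite /X /= pS pE; have := uK n; rewrite ler_norml => /andP[]; lra.
exists l => n; have := Hl n; rewrite /X /= => /andP[h1 h2].
by rewrite ler_norml; apply/andP; split; lra.
Qed.

Lemma geom_lim S (K : R) : (forall n, nm (S n.+1 - S n) <= K / 2 ^+ n) ->
  exists l, cconv S l.
Proof.
move=> SK; have K0 : 0 <= K by have := SK 0%N; rewrite expr0 divr1; apply: le_trans; exact: nm_ge0.
have [|x Hx] := @real_geom_lim (fun n => complex.Re (S n)) K K0.
  move=> n; apply: le_trans (SK n); apply: le_trans (Re_le_nm _).
  by case: (S n.+1) (S n) => [? ?] [? ?].
have [|y Hy] := @real_geom_lim (fun n => complex.Im (S n)) K K0.
  move=> n; apply: le_trans (SK n); apply: le_trans (Im_le_nm _).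
  by case: (S n.+1) (S n) => [? ?] [? ?].
exists (x +i* y) => e e0; have [n0 Hn0] := pow2_gt (4 * K) e0.
exists n0 => n nn0; apply: le_trans (nm_le_ReIm _) _.
have -> : complex.Re (S n - x +i* y) = complex.Re (S n) - x by case: (S n).
have -> : complex.Im (S n - x +i* y) = complex.Im (S n) - y by case: (S n).
have : 4 * K / 2 ^+ n <= 4 * K / 2 ^+ n0.
  rewrite ler_wpM2l ?mulr_ge0 // lef_pV2 ?posrE ?exprn_gt0 //.
  by rewrite ler_eXn2l // ltr1n.
have -> : 4 * K / 2 ^+ n = 2 * K / 2 ^+ n + 2 * K / 2 ^+ n by ring.
by have := Hx n; have := Hy n; lra.
Qed.

Definition psum a n w := \sum_(k < n) a k * w ^+ k.

(** Infinite radius of convergence, as Cauchy estimates on the coefficients. *)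
Definition fast_decay a := forall r : R, 0 < r ->
  exists K, forall k, nm (a k) * r ^+ k <= K.

Lemma psumS a n w : psum a n.+1 w = psum a n w + a n * w ^+ n.
Proof. by rewrite /psum big_ord_recr. Qed.

Lemma fast_decay_half a (r : R) : fast_decay a -> 0 < r ->
  exists2 K, 0 <= K & forall k, nm (a k) * r ^+ k <= K / 2 ^+ k.
Proof.
move=> fa r0; have r2 : 0 < 2 * r by lra.
have [K HK] := fa _ r2; exists K.
  by have := HK 0%N; rewrite expr0 mulr1; apply: le_trans; exact: nm_ge0.
move=> k; rewrite ler_pdivlMr ?exprn_gt0 // -mulrA -exprMn [r * 2]mulrC.
exact: HK.
Qed.

(** A second-order Taylor bound with a constant explicit in [k], so that it can be summed against
    coefficients. The induction closes since k^2 + k <= (k+1)^2, and [1 <= r] lets lower powers of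
    [r] be raised. *)
Lemma expr_remainder z h k (r : R) : 1 <= r -> nm z <= r -> nm (z + h) <= r ->
  nm ((z + h) ^+ k - z ^+ k - k%:R * z ^+ k.-1 * h) <= (k%:R ^+ 2 * r ^+ k) * nm h ^+ 2.
Proof.
move=> r1 zr zhr; have r0 : 0 <= r by lra.
elim: k => [|k IH].
  by rewrite !expr0 subrr !mul0r subr0 nm0 expr0n /= !mul0r.
have -> : (z + h) ^+ k.+1 - z ^+ k.+1 - k.+1%:R * z ^+ k.+1.-1 * h =
    (z + h) * ((z + h) ^+ k - z ^+ k - k%:R * z ^+ k.-1 * h) + k%:R * z ^+ k.-1 * h ^+ 2.
  case: k {IH} => [|k] /=; first by rewrite !expr1 !expr0; ring.
  have -> : k.+2%:R = k.+1%:R + 1 :> C by rewrite natr1.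
  by rewrite !exprS; ring.
apply: le_trans (nmD _ _) _; rewrite !nmM !nmX nmn.
have rk : 0 <= r ^+ k by rewrite exprn_ge0.
have zk : nm z ^+ k.-1 <= r ^+ k.+1.
  apply: le_trans (_ : r ^+ k.-1 <= _).
    by apply: lerXn2r; rewrite ?nnegrE ?nm_ge0.
  by rewrite ler_weXn2l // (leq_trans (leq_pred k)).
have h2 : 0 <= nm h ^+ 2 by rewrite sqr_ge0.
have A1 : nm (z + h) * nm ((z + h) ^+ k - z ^+ k - k%:R * z ^+ k.-1 * h) <=
     r * (k%:R ^+ 2 * r ^+ k * nm h ^+ 2) by rewrite ler_pM ?nm_ge0.
have A2 : k%:R * nm z ^+ k.-1 * nm h ^+ 2 <= k%:R * r ^+ k.+1 * nm h ^+ 2.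
  by rewrite ler_wpM2r // ler_wpM2l.
apply: le_trans (lerD A1 A2) _.
have -> : r * (k%:R ^+ 2 * r ^+ k * nm h ^+ 2) + k%:R * r ^+ k.+1 * nm h ^+ 2
   = (k%:R ^+ 2 + k%:R) * (r ^+ k.+1 * nm h ^+ 2) by rewrite [r ^+ k.+1]exprS; ring.
have rh : 0 <= r ^+ k.+1 * nm h ^+ 2 by apply: mulr_ge0 => //; apply: exprn_ge0.
rewrite -[leRHS]mulrA; apply: ler_wpM2r => //.
by rewrite -natr1; have := ler0n R k; nra.
Qed.

Lemma natr_le_pow2 k : k%:R <= 2 ^+ k :> R.
Proof. by rewrite -natrX ler_nat ltnW // ltn_expl. Qed.

Lemma sum_geom_le (K : R) n : 0 <= K -> \sum_(k < n) K / 2 ^+ k <= 2 * K.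
Proof.
move=> K0; suff -> : \sum_(k < n) K / 2 ^+ k = 2 * K - 2 * K / 2 ^+ n.
  by rewrite lerBlDr lerDl divr_ge0 ?mulr_ge0 // exprn_ge0.
elim: n => [|n IH]; first by rewrite big_ord0 expr0 divr1 subrr.
by rewrite big_ord_recr /= IH exprS; field; rewrite expf_neq0 // pnatr_eq0.
Qed.

Lemma nm_sum_le (I : Type) (r : seq I) (F : I -> C) (G : I -> R) :
  (forall i, nm (F i) <= G i) -> nm (\sum_(i <- r) F i) <= \sum_(i <- r) G i.
Proof.
move=> FG; elim: r => [|i r IH]; first by rewrite !big_nil nm0.
by rewrite !big_cons (le_trans (nmD _ _)) // lerD.
Qed.

Lemma power_series a : fast_decay a ->
  exists2 P : C -> C, entireH P & forall w, cconv (psum a ^~ w) (P w).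
Proof.
move=> fa.
have cv w : exists l, cconv (psum a ^~ w) l.
  have w1 : 0 < nm w + 1 by have := nm_ge0 w; lra.
  have [K K0 HK] := fast_decay_half fa w1.
  apply: (@geom_lim _ K) => n; rewrite psumS addrC addKr nmM nmX.
  apply: le_trans (HK n); rewrite ler_wpM2l ?nm_ge0 //.
  by apply: lerXn2r; rewrite ?nnegrE ?nm_ge0 // ?lerDl // ltW.
have [P HP] := choice cv; exists P => // w.
have w1 : 1 <= nm w + 1 by have := nm_ge0 w; lra.
(* The factor 4 absorbs the [k%:R ^+ 2] of [expr_remainder], as k^2 <= 4^k; [fast_decay_half] adds a
   geometric factor for the summation. *)
have w4 : 0 < 4 * (nm w + 1) by lra.
have [K K0 HK] := fast_decay_half fa w4.
pose b k := a k * k%:R.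
pose dsum n := \sum_(k < n) b k * w ^+ k.-1.
have [d Hd] : exists d, cconv dsum d.
  apply: (@geom_lim _ K) => n; rewrite /dsum big_ord_recr /= [X in nm X]addrAC.
  rewrite subrr add0r !nmM nmX nmn.
  apply: le_trans (HK n); rewrite exprMn mulrA -mulrA -[leRHS]mulrA ler_wpM2l ?nm_ge0 //.
  apply: ler_pM; rewrite ?exprn_ge0 ?nm_ge0 //.
    apply: le_trans (natr_le_pow2 n) _; apply: lerXn2r; rewrite ?nnegrE //; lra.
  apply: le_trans (_ : (nm w + 1) ^+ n.-1 <= _).
    apply: lerXn2r; rewrite ?nnegrE ?nm_ge0 //; lra.
  by rewrite ler_weXn2l // leq_pred.
exists d; apply: (@cderiv_quad _ _ _ _ (2 * K) 1) => // h h1.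
have := cconvD (cconvD (HP (w + h)) (cconvZ (-1) (HP w))) (cconvZ (- h) Hd).
have -> : P (w + h) + -1 * P w + - h * d = P (w + h) - P w - d * h by ring.
move=> /cconv_le; apply => n.
have -> : psum a n (w + h) + -1 * psum a n w + - h * dsum n =
   \sum_(k < n) a k * ((w + h) ^+ k - w ^+ k - k%:R * w ^+ k.-1 * h).
  rewrite /psum /dsum !mulr_sumr -!big_split /=; apply: eq_bigr => k _.
  by rewrite /b; ring.
have whr : nm (w + h) <= nm w + 1 by have := nmD w h; lra.
have wr : nm w <= nm w + 1 by lra.
apply: le_trans (_ : \sum_(k < n) (K / 2 ^+ k) * nm h ^+ 2 <= _); last first.
  by rewrite -mulr_suml ler_wpM2r ?sqr_ge0 // sum_geom_le.
apply: nm_sum_le => k; rewrite nmM.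
have := expr_remainder k w1 wr whr => /(ler_wpM2l (nm_ge0 (a k))).
move=> /le_trans; apply; rewrite (mulrA (nm (a k))); apply: ler_wpM2r; first exact: sqr_ge0.
apply: le_trans (HK k); apply: ler_wpM2l; first exact: nm_ge0.
rewrite exprMn; apply: ler_wpM2r; first by apply: exprn_ge0; lra.
have -> : 4 = 2 ^+ 2 :> R by ring.
by rewrite -exprM mulnC exprM; apply: lerXn2r; rewrite ?nnegrE ?exprn_ge0 // natr_le_pow2.
Qed.

End PowerSeries.

(** * Euler's infinite product through its power series *)

Section Euler.
Variable R : realType.
Local Notation C := R[i].
Variable q : C.
Hypothesis q_lt1 : nm q < 1.

Lemma pow_small (e : R) : 0 < e -> exists n0, forall n, (n0 <= n)%N -> nm q ^+ n < e.
Proof.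
move=> e0; have q1 : `|nm q| < 1 by rewrite ger0_norm ?nm_ge0.
have /cvgrPdist_lt /(_ _ e0) [n0 _ H] := cvg_expr q1.
exists n0 => n /H /=; rewrite sub0r normrN ger0_norm // exprn_ge0 ?nm_ge0 //.
Qed.

Lemma expr_neq1 n : 1 - q ^+ n.+1 != 0.
Proof.
rewrite subr_eq0; apply/eqP => /(congr1 (@nm R)); rewrite nm1 nmX => E.
have : nm q ^+ n.+1 < 1 by rewrite exprn_ilt1 ?nm_ge0.
by rewrite -E ltxx.
Qed.

(* Coefficients of Euler's expansion of [\prod_(k >= 0) (1 - q ^+ k * w)]. *)
Fixpoint euler_coef (n : nat) : C :=
  if n is m.+1 then - (q ^+ m / (1 - q ^+ m.+1)) * euler_coef m else 1.

(** The ratio of successive terms is [nm q ^+ m * r / nm (1 - q ^+ m.+1)], at most 1 once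
    [nm q ^+ m < (1 - nm q) / r]. From there on the terms do not increase, and the sum of the
    earlier ones bounds them all. *)
Lemma euler_coef_decay : fast_decay euler_coef.
Proof.
move=> r r0; have q1 : 0 < 1 - nm q by rewrite subr_gt0.
have [n0 Hn0] := pow_small (divr_gt0 q1 r0).
pose b k := nm (euler_coef k) * r ^+ k.
have b0 k : 0 <= b k by rewrite mulr_ge0 ?nm_ge0 ?exprn_ge0 // ltW.
exists (\sum_(k < n0.+1) b k) => k; rewrite -/(b k).
have small j : (j <= n0)%N -> b j <= \sum_(k < n0.+1) b k.
  move=> jn; rewrite (bigD1 (inord j)) //= inordK // lerDl.
  by apply: sumr_ge0.
have [/small //|/ltnW] := leqP k n0.
move=> /subnKC <-; elim: (k - n0)%N => [|j IH]; first by rewrite addn0 small.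
apply: le_trans IH; rewrite addnS /b /= nmM nmN nmM nmV nmX [r ^+ _]exprS.
set m := (n0 + j)%N.
have Hm : nm q ^+ m < (1 - nm q) / r by apply: Hn0; rewrite leq_addr.
have D : 1 - nm q <= nm (1 - q ^+ m.+1).
  have : nm q ^+ m.+1 <= nm q.
    rewrite exprS ler_piMr ?nm_ge0 // exprn_ile1 ?nm_ge0 // ltW //.
  by have := nmD (1 - q ^+ m.+1) (q ^+ m.+1); rewrite subrK nm1 nmX; lra.
have D0 : 0 < nm (1 - q ^+ m.+1) by apply: lt_le_trans D.
have -> : nm q ^+ m / nm (1 - q ^+ m.+1) * nm (euler_coef m) * (r * r ^+ m) =
  (nm q ^+ m / nm (1 - q ^+ m.+1) * r) * (nm (euler_coef m) * r ^+ m) by ring.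
rewrite ler_piMl ?b0 // mulrAC ler_pdivrMr // mul1r.
by move: Hm; rewrite ltr_pdivlMr // => /ltW /le_trans; apply.
Qed.

Lemma euler_function : exists P : C -> C, [/\ entireH P, P 0 = 1 &
  forall w, P w = (1 - w) * P (q * w)].
Proof.
have [P Ph Pc] := power_series euler_coef_decay; exists P; split=> //.
  apply: (cconv_uniq (Pc 0)) => e e0; exists 1%N => -[//|n] _.
  rewrite /psum big_ord_recl /= mul1r expr0 big1 ?addr0 ?subrr ?nm0 ?ltW // => i _.
  by rewrite expr0n /= mulr0n mulr0.
move=> w.
have := cconvD (Pc w) (cconvZ (- (1 - w)) (Pc (q * w))).
move=> cv; apply/eqP; rewrite -subr_eq0 -mulNr; apply/eqP.
apply: (cconv_uniq cv) => e e0.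
have w1 : 0 < nm w + 1 by have := nm_ge0 w; lra.
have [K K0 HK] := fast_decay_half euler_coef_decay w1.
have [n0 Hn0] := pow2_gt (2 * K) e0; exists n0 => n nn0; rewrite subr0.
(* The recursion of [euler_coef] makes the defect of the functional equation telescope to one
   boundary term, which tends to 0. *)
have -> : psum euler_coef n w + - (1 - w) * psum euler_coef n (q * w) =
   - (euler_coef n * (1 - q ^+ n) * w ^+ n).
  elim: (n) => [|m IH].
    by rewrite /psum !big_ord0 mulr0 addr0 expr0 subrr mulr0 mul0r oppr0.
  rewrite !psumS mulrDr addrACA IH /=.
  have E : euler_coef m.+1 * (1 - q ^+ m.+1) = - q ^+ m * euler_coef m.
    by rewrite /=; field; exact: expr_neq1.
  by rewrite /= in E; rewrite E exprMn exprS; ring.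
rewrite nmN !nmM nmX.
have q2 : nm (1 - q ^+ n) <= 2.
  apply: le_trans (nmB _ _) _; rewrite nm1 nmX.
  have : nm q ^+ n <= 1 by rewrite exprn_ile1 ?nm_ge0 // ltW.
  lra.
have wn : nm w ^+ n <= (nm w + 1) ^+ n.
  by apply: lerXn2r; rewrite ?nnegrE ?nm_ge0 ?(ltW w1) // lerDl.
have : 2 * K / 2 ^+ n <= 2 * K / 2 ^+ n0.
  rewrite ler_wpM2l ?mulr_ge0 // lef_pV2 ?posrE ?exprn_gt0 //.
  by rewrite ler_eXn2l // ltr1n.
have : nm (euler_coef n) * nm (1 - q ^+ n) * nm w ^+ n <=
    2 * (nm (euler_coef n) * (nm w + 1) ^+ n).
  have -> : 2 * (nm (euler_coef n) * (nm w + 1) ^+ n) =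
     nm (euler_coef n) * 2 * (nm w + 1) ^+ n by ring.
  by rewrite ler_pM ?mulr_ge0 ?nm_ge0 ?exprn_ge0 ?nm_ge0 // ler_wpM2l ?nm_ge0.
by have := HK n; rewrite -[2 * K / 2 ^+ n]mulrA; lra.
Qed.

(** Otherwise the functional equation propagates the zero to all [q ^+ n * w]; these tend to 0,
    where [P] is 1. *)
Lemma euler_zero P w : entireH P -> P 0 = 1 -> (forall w, P w = (1 - w) * P (q * w)) ->
  P w = 0 -> exists n, q ^+ n * w = 1.
Proof.
move=> Ph P0 PE Pw; apply: contrapT => /forallNP H.
have Pq n : P (q ^+ n * w) = 0.
  elim: n => [|n IH]; first by rewrite mul1r.
  move: IH; rewrite PE => /eqP; rewrite mulf_eq0 subr_eq0 => /orP[/eqP E|/eqP].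
    by case: (H n).
  by rewrite mulrA -exprS.
have [k k0 Hk] : exists2 k : R, 0 < k & forall u, nm (u - 0) < k -> P u != 0.
  by apply: holo_neq0 => //; rewrite P0 oner_neq0.
have w1 : 0 < nm w + 1 by have := nm_ge0 w; lra.
have [n /(_ _ (leqnn n)) Hn] := pow_small (divr_gt0 k0 w1).
have /eqP := Pq n; apply/negP; apply: Hk.
rewrite subr0 nmM nmX; rewrite ltr_pdivlMr // in Hn.
by apply: le_lt_trans Hn; rewrite ler_wpM2l ?exprn_ge0 ?nm_ge0 // lerDl.
Qed.

End Euler.

(** * Orders of vanishing and the theta function *)

Section ZeroOrder.
Variable R : realType.
Local Notation C := R[i].
Implicit Types (z w b : C) (f g h : C -> C) (m : nat).

Definition zord f z m := exists g, [/\ g z != 0, holo_near g z &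
  exists2 k : R, 0 < k & forall u, nm (u - z) < k -> f u = (u - z) ^+ m * g u].

Lemma zero_order_zord f z m : zero_order f z m -> zord f z m.
Proof.
move=> [g [gz /near_nm[k k0 Hk] /near_nm[l l0 Hl]]]; exists g; split=> //.
  by exists k => // u /Hk; exact: derivable_holo.
by exists l.
Qed.

Lemma zord0 f z : entireH f -> f z != 0 -> zord f z 0.
Proof.
move=> fh fz; exists f; split=> //; first by exists 1.
by exists 1 => // u _; rewrite mul1r.
Qed.

Lemma zordM f g z m n : zord f z m -> zord g z n -> zord (fun u => f u * g u) z (m + n).
Proof.
move=> [f1 [f1z [k1 k10 K1] [k2 k20 K2]]] [g1 [g1z [k3 k30 K3] [k4 k40 K4]]].
exists (fun u => f1 u * g1 u); split; first by rewrite mulf_neq0.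
  exists (Num.min k1 k3) => [|u]; first by rewrite lt_min k10.
  by rewrite lt_min => /andP[/K1 ? /K3 ?]; apply: holoM.
exists (Num.min k2 k4) => [|u]; first by rewrite lt_min k20.
by rewrite lt_min => /andP[/K2 -> /K4 ->]; rewrite exprD; ring.
Qed.

Lemma zord_ext f g z m : f =1 g -> zord f z m -> zord g z m.
Proof.
move=> fg [f1 [f1z fh [k k0 K]]]; exists f1; split=> //; exists k => // u.
by rewrite -fg; exact: K.
Qed.

Lemma zord_shift f z b m : zord f (z + b) m -> zord (fun u => f (u + b)) z m.
Proof.
move=> [f1 [f1z [k1 k10 K1] [k2 k20 K2]]]; exists (fun u => f1 (u + b)).
have E u : u + b - (z + b) = u - z by ring.
split=> //.
  exists k1 => // u uz; apply: holo_comp; first by apply: K1; rewrite E.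
  by apply: holoD; [exact: holo_id | exact: holo_cst].
by exists k2 => // u uz; rewrite K2 ?E.
Qed.

Lemma zord_isolated f z m : zord f z m ->
  exists2 k : R, 0 < k & forall u, nm (u - z) < k -> u != z -> f u != 0.
Proof.
move=> [g [gz [k1 k10 K1] [k2 k20 K2]]].
have gzh : holo g z by apply: K1; rewrite subrr nm0.
have [k3 k30 K3] := holo_neq0 gzh gz.
exists (Num.min k2 k3) => [|u]; first by rewrite lt_min k20.
rewrite lt_min => /andP[/K2 -> /K3 gu] uz.
by rewrite mulf_neq0 // expf_neq0 // subr_eq0.
Qed.

(** [f] can be cancelled off its zeros, which are isolated; by continuity [g - h] cannot be nonzero
    at a single isolated point. *)
Lemma zord_cancel f g h : entireH g -> entireH h ->
  (forall z, exists m, zord f z m) -> (forall z, g z * f z = h z * f z) -> forall z, g z = h z.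
Proof.
move=> gh hh fz E z; apply/eqP; rewrite -subr_eq0; apply/negPn/negP => d0.
have dh : entireH (fun z => g z - h z) by move=> u; exact: holoB.
have [k k0 K] := holo_neq0 (dh z) d0.
have [m /zord_isolated[l l0 L]] := fz z.
pose e := Num.min k l / 2.
have e0 : 0 < Num.min k l by rewrite lt_min k0.
have nme : nm e%:C = e by rewrite nmR ger0_norm // divr_ge0 // ltW.
have uz : nm (z + e%:C - z) < Num.min k l.
  by rewrite addrAC subrr add0r nme /e ltr_pdivrMr // mulr_natr mulr2n ltrDl.
move: (uz); rewrite lt_min => /andP[/K gu /L fu].
have {}fu : f (z + e%:C) != 0.
  apply: fu; rewrite -subr_eq0 addrAC subrr add0r -nm_gt0 nme.
  by rewrite divr_gt0.
by case/eqP: gu; apply: (mulIf fu); rewrite mul0r mulrBl E subrr.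
Qed.

(** With equal orders the powers of [u - z] cancel, and the quotient of the local cofactors is
    holomorphic and nonzero. These local quotients supply the values of f/g at the zeros of [g]. *)
Lemma zord_quotient f g : (forall z, exists2 m, zord f z m & zord g z m) ->
  exists h, [/\ entireH h, forall z, h z != 0 & forall z, f z = h z * g z].
Proof.
move=> fg.
have loc z : exists h, [/\ holo_near h z, h z != 0 &
    exists2 k : R, 0 < k & forall u, nm (u - z) < k -> f u = h u * g u].
  have [m [f1 [f1z [k1 k10 K1] [k2 k20 K2]]] [g1 [g1z [k3 k30 K3] [k4 k40 K4]]]] := fg z.
  have g1h : holo g1 z by apply: K3; rewrite subrr nm0.
  have [k5 k50 K5] := holo_neq0 g1h g1z.
  exists (fun u => f1 u / g1 u); split.
  - exists (Num.min k1 (Num.min k3 k5)) => [|u]; first by rewrite !lt_min k10 k30.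
    rewrite !lt_min => /and3P[/K1 ? /K3 ? /K5 ?].
    by apply: holoM => //; exact: holo_inv.
  - by rewrite mulf_neq0 // invr_eq0.
  exists (Num.min k2 (Num.min k4 k5)) => [|u]; first by rewrite !lt_min k20 k40.
  rewrite !lt_min => /and3P[/K2 -> /K4 -> /K5 ?].
  by rewrite mulrCA divfK.
have [H HH] := choice loc.
pose h z := if g z == 0 then H z z else f z / g z.
have hE z : f z = h z * g z.
  rewrite /h; case: eqVneq => [gz|gz]; last by rewrite divfK.
  by have [_ _ [k k0 K]] := HH z; rewrite K ?subrr ?nm0 // gz mulr0 mulr0.
have hloc z : exists2 k : R, 0 < k & forall u, nm (u - z) < k -> h u = H z u.
  have [_ _ [k k0 K]] := HH z; have [m _ /zord_isolated[l l0 L]] := fg z.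
  exists (Num.min k l) => [|u]; first by rewrite lt_min k0.
  rewrite lt_min => /andP[uk ul]; have [->|uz] := eqVneq u z.
    rewrite /h; case: eqVneq => // gz; apply: (mulIf gz).
    by rewrite divfK // K // subrr nm0.
  by rewrite /h (negPf (L _ ul uz)) K // mulfK // L.
exists h; split=> // z.
  have [[k k0 K] _ _] := HH z; have [l l0 L] := hloc z.
  apply: (@holo_ext _ (H z) _ _ l) => //; first by move=> u /L.
  by apply: K; rewrite subrr nm0.
have [l l0 L] := hloc z; rewrite L ?subrr ?nm0 //.
by have [] := HH z.
Qed.

End ZeroOrder.

(** * The lattice, theta functions and the location of zeros *)

Section Theta.
Variable R : realType.
Local Notation C := R[i].
Variable tau : C.
Hypothesis tau_gt0 : 0 < complex.Im tau.
Implicit Types (z w b s : C) (f g h : C -> C) (m n : nat) (N : int).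

Definition inL w := exists k l : int, w = k%:~R + l%:~R * tau.

Lemma inL_int (k : int) : inL k%:~R.
Proof. by exists k, 0; rewrite mul0r addr0. Qed.

Lemma inL_tau : inL tau.
Proof. by exists 0, 1; rewrite mul1r add0r. Qed.

Lemma inLD w w' : inL w -> inL w' -> inL (w + w').
Proof.
move=> [k [l ->]] [k' [l' ->]]; exists (k + k'), (l + l').
by rewrite !rmorphD /=; ring.
Qed.

Lemma inLN w : inL w -> inL (- w).
Proof. by move=> [k [l ->]]; exists (- k), (- l); rewrite !rmorphN /=; ring. Qed.

Lemma inLB w w' : inL w -> inL w' -> inL (w - w').
Proof. by move=> Lw /inLN; exact: inLD. Qed.

(** Any zero-free entire multiplier is allowed: orders of vanishing are still invariant, and such
    periods form a group, so 1 and [tau] suffice. *)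
Definition mult_period f w := exists E : C -> C,
  [/\ entireH E, forall u, E u != 0 & forall u, f (u + w) = f u * E u].

Lemma mult_periodD f w w' : mult_period f w -> mult_period f w' -> mult_period f (w + w').
Proof.
move=> [E [Eh E0 fE]] [F [Fh F0 fF]]; exists (fun u => E u * F (u + w)); split.
- by apply: entireM => //; exact: entire_shift.
- by move=> u; rewrite mulf_neq0.
- by move=> u; rewrite addrA fF fE mulrA.
Qed.

Lemma mult_periodN f w : mult_period f w -> mult_period f (- w).
Proof.
move=> [E [Eh E0 fE]]; exists (fun u => (E (u - w))^-1); split.
- by move=> u; apply: holo_inv => //; exact: entire_shift.
- by move=> u; rewrite invr_eq0.
- by move=> u; rewrite -[in RHS](subrK w u) fE addrK mulfK.
Qed.

Lemma mult_period_int f w (k : int) : mult_period f w -> mult_period f (k%:~R * w).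
Proof.
move=> fw; have H (n : nat) : mult_period f (n%:R * w).
  elim: n => [|n IH]; last by rewrite -natr1 mulrDl mul1r; exact: mult_periodD.
  exists (fun=> 1); split=> [u|u|u]; [exact: holo_cst|exact: oner_neq0|].
  by rewrite mul0r addr0 mulr1.
case: k => n; first exact: H.
by rewrite NegzE rmorphN mulNr; apply: mult_periodN; exact: H.
Qed.

Lemma mult_period_inL f w : mult_period f 1 -> mult_period f tau -> inL w -> mult_period f w.
Proof.
move=> f1 ft [k [l ->]]; apply: mult_periodD; last exact: mult_period_int.
by rewrite -[k%:~R]mulr1; exact: mult_period_int.
Qed.

Lemma zord_mult_period f w z m : mult_period f w -> zord f z m -> zord f (z + w) m.
Proof.
move=> /mult_periodN[E [Eh E0 fE]] fz.
have : zord (fun u => f (u - w) * (E u)^-1) (z + w) m.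
  rewrite -[m]addn0; apply: zordM; first by apply: zord_shift; rewrite addrK.
  by apply: zord0; [move=> u; exact: holo_inv | rewrite invr_eq0].
by apply: zord_ext => u; rewrite fE -mulrA mulfV // mulr1.
Qed.

Lemma ec_affine_entire (a b : C) : entireH (fun u => ec (a * u + b)).
Proof.
move=> u; apply: holo_comp; first exact: holo_ec.
apply: holoD; last exact: holo_cst.
by apply: holoM; [exact: holo_cst | exact: holo_id].
Qed.

Lemma qper_mult_period N s g w : qper tau N s g -> inL w -> mult_period g w.
Proof.
move=> [gh g1 gt]; apply: mult_period_inL.
  exists (fun=> 1); split=> [u|u|u]; [exact: holo_cst|exact: oner_neq0|].
  by rewrite g1 mulr1.
exists (fun u => ec (- N%:~R * u + - s)); split=> [|u|u]; first exact: ec_affine_entire.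
  exact: ec_neq0.
by rewrite gt mulNr.
Qed.

Lemma qperM N N' s s' f g : qper tau N s f -> qper tau N' s' g ->
  qper tau (N + N') (s + s') (fun u => f u * g u).
Proof.
move=> [fh f1 ft] [gh g1 gt]; split; first exact: entireM.
  by move=> u; rewrite f1 g1.
move=> u; rewrite ft gt mulrACA -ecD; congr (_ * ec _).
by rewrite rmorphD /=; ring.
Qed.

Lemma qperV N s f : (forall z, f z != 0) -> qper tau N s f ->
  qper tau (- N) (- s) (fun u => (f u)^-1).
Proof.
move=> f0 [fh f1 ft]; split; first by move=> u; exact: holo_inv.
  by move=> u; rewrite f1.
move=> u; rewrite ft invfM -ecN; congr (_ * ec _).
by rewrite rmorphN /=; ring.
Qed.

Lemma qper_shift N s f b : qper tau N s f -> qper tau N (s + N%:~R * b) (fun u => f (u + b)).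
Proof.
move=> [fh f1 ft]; split; first exact: entire_shift.
  by move=> u; rewrite addrAC f1.
by move=> u; rewrite addrAC ft; congr (_ * ec _); ring.
Qed.

Lemma qper_neq0 N s f : (forall z, f z != 0) -> qper tau N s f -> N = 0 /\ inL s.
Proof.
move=> f0 fq; have [N0|N0|N0] := ltgtP N 0.
- by have /eqP := qper_neg tau_gt0 N0 fq 0; rewrite (negPf (f0 _)).
- have N0' : - N < 0 by rewrite oppr_lt0.
  have /eqP := qper_neg tau_gt0 N0' (qperV f0 fq) 0.
  by rewrite invr_eq0 (negPf (f0 _)).
by split=> //; rewrite N0 in fq; exact: qper_zero fq (f0 0).
Qed.

Lemma ec_half : ec (2^-1 : C) = -1.
Proof.
rewrite /ec twopiiE.
have -> : (0 +i* (2 * pi)) / 2 = 0 +i* pi :> C.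
  have -> : 0 +i* (2 * pi) = 2 * (0 +i* pi) :> C.
    by apply/eqP; rewrite eq_complex /=; apply/andP; split; apply/eqP; ring.
  by rewrite mulrAC mulfV ?mul1r // pnatr_eq0.
rewrite /cexp /= expR0 cospi sinpi mul1r.
by apply/eqP; rewrite eq_complex /= oppr0 !eqxx.
Qed.

Lemma nm_q : nm (ec tau) < 1.
Proof. by rewrite nm_ec expR_lt1 oppr_lt0 !mulr_gt0 ?pi_gt0. Qed.

(* The Jacobi theta function in its product form
   [\prod_(k >= 0) (1 - q^k e(u)) * \prod_(k >= 1) (1 - q^k e(-u))], [q = e(tau)]. *)
Lemma theta_function : exists th : C -> C, qper tau 1 (- 2^-1) th /\
  forall z, zord th z (`[< inL z >] : bool).
Proof.
have [P [Ph P0 PE]] := euler_function nm_q.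
set q := ec tau in PE.
have Pz w : P w = 0 -> exists n, q ^+ n * w = 1.
  exact: (euler_zero nm_q Ph P0 PE).
pose th u := P (ec u) * P (q * ec (- u)).
have thP : qper tau 1 (- 2^-1) th.
  split.
  - move=> u; apply: holoM; first by apply: holo_comp => //; exact: holo_ec.
    apply: holo_comp => //; apply: holoM; first exact: holo_cst.
    by apply: holo_comp; [exact: holo_ec | apply: holoN; exact: holo_id].
  - by move=> u; rewrite /th opprD !ecD (ecN 1) ec1 invr1 !mulr1.
  move=> u; rewrite /th mul1r ecD -/q opprK ecD ec_half opprD ecD !ecN -/q.
  have x0 : ec u != 0 by exact: ec_neq0.
  have q0 : q != 0 by exact: ec_neq0.
  (* Both sides are expanded to the factors [P (q * ec u)] and [P (q * ec (- u))]; what remains is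
     (1 - e(-u)) / (1 - e(u)) = - e(-u), and the sign is the constant -1/2. *)
  rewrite [q * _]mulrCA mulfV // mulr1 (PE (ec u)) (PE (ec u)^-1) [ec u * q]mulrC.
  by field.
exists th; split=> // z.
have [Lz|nLz] := asboolP (inL z); last first.
  apply: zord0; first by have [] := thP.
  rewrite mulf_neq0 //; apply/eqP => /Pz[n] /eqP.
    rewrite ecX -ecD => /eqP /ec_eq1[k E]; apply: nLz.
    exists k, (- n%:Z); rewrite -E rmorphN /=; ring.
  rewrite mulrA -exprSr ecX -ecD => /eqP /ec_eq1[k E]; apply: nLz.
  exists (- k), (n.+1%:Z); rewrite rmorphN /= -E; ring.
rewrite -[z]add0r; apply: zord_mult_period; first exact: qper_mult_period thP Lz.
have Pq : P q != 0.
  apply/eqP => /Pz[n]; rewrite -exprSr => /(congr1 (@nm R)); rewrite nm1 nmX => E.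
  have : nm q ^+ n.+1 < 1 by rewrite exprn_ilt1 ?nm_ge0 //; exact: nm_q.
  by rewrite E ltxx.
(* The cofactor is the difference quotient at 0, completed by the derivative -2 i pi, which is
   nonzero. The other factors of [th] take the value [P q] at 0. *)
have e1 : zord (fun u : C => 1 - ec u) 0 1.
  have d1 u : cderiv (fun u => 1 - ec u) u (- (twopii R * ec u)).
    have := cderivM (cderiv_cst (-1) u) (cderiv_ec u).
    move=> /(cderivD (cderiv_cst 1 u)); rewrite mul0r !add0r mulN1r.
    by apply: (@cderiv_ext _ _ _ _ _ 1) => // v _; rewrite mulN1r.
  have [D d2] : exists D, cderiv (fun u => - (twopii R * ec u)) 0 D.
    by apply: holoN; apply: holoM; [exact: holo_cst | exact: holo_ec].
  exists (fun v : C => if v == 0 then - (twopii R * ec 0)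
    else ((1 - ec v) - (1 - ec 0)) / (v - 0)); split.
  - rewrite /= eqxx ec0 mulr1 oppr_eq0 twopiiE eq_complex /= negb_and orbC.
    by rewrite mulf_neq0 ?pnatr_eq0 // gt_eqF ?pi_gt0.
  - by exists 1 => // u _; exact: (cderiv_dq d1 d2).
  exists 1 => // u _; rewrite expr1 /=; case: eqVneq => [->|u0].
    by rewrite ec0 !subrr mul0r.
  by rewrite ec0 subrr !subr0 mulrC divfK.
have : zord (fun u => (1 - ec u) * (P (q * ec u) * P (q * ec (- u)))) 0 (1 + 0).
  apply: zordM => //; apply: zord0; last by rewrite oppr0 ec0 !mulr1 mulf_neq0.
  move=> u; apply: holoM; apply: holo_comp => //; apply: holoM; try exact: holo_cst.
    exact: holo_ec.
  by apply: holo_comp; [exact: holo_ec | apply: holoN; exact: holo_id].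
by apply: zord_ext => u; rewrite /th (PE (ec u)) mulrA.
Qed.

(** A product of translates: each factor [th (u - b)] has degree 1 and adds - b - 1/2 to the
    constant. *)
Lemma theta_product (zs : seq C) : exists Th : C -> C,
  qper tau (size zs)%:Z (- (\sum_(b <- zs) b + (size zs)%:R / 2)) Th /\
  forall z, zord Th z (count (fun b => `[< inL (z - b) >]) zs).
Proof.
have [th [thq thz]] := theta_function; elim: zs => [|b zs [Th [Tq Tz]]].
  exists (fun=> 1); split=> [|z]; last first.
    by apply: zord0; [move=> u; exact: holo_cst | exact: oner_neq0].
  rewrite big_nil mul0r addr0 oppr0; split=> [u|//|u]; first exact: holo_cst.
  by rewrite mulr0z mul0r !oppr0 addr0 ec0 mulr1.
exists (fun u => th (u - b) * Th u); split=> [|z]; last first.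
  apply: zordM => //; apply: (@zord_shift _ th z (- b)); exact: thz.
have := qperM (qper_shift (- b) thq) Tq.
rewrite /= intS big_cons; congr (qper _ _ _ _).
by rewrite -natr1; field.
Qed.

Lemma zeros_quasi_period N s g (zs : seq C) : qper tau N s g ->
  (forall z, zord g z (count (fun b => `[< inL (z - b) >]) zs)) ->
  N = (size zs)%:Z /\ inL (s + \sum_(b <- zs) b + (size zs)%:R / 2).
Proof.
move=> gq gz; have [Th [Tq Tz]] := theta_product zs.
have [|h [hh h0 hE]] := @zord_quotient _ g Th.
  by move=> z; exists (count (fun b => `[< inL (z - b) >]) zs).
set N' := (size zs)%:Z in Tq *; set s' := - _ in Tq.
have [gh g1 gt] := gq; have [Tgh Tg1 Tgt] := Tq.
have Tz' z : exists m, zord Th z m by eexists; exact: Tz.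
(* The relations for [h] are visible only after multiplication by [Th]; [zord_cancel] removes this
   factor, also at its zeros. *)
have hq : qper tau (N - N') (s - s') h.
  split=> //.
    apply: (zord_cancel (entire_shift 1 hh) hh Tz') => z.
    by rewrite -{1}Tg1 -!hE g1.
  apply: (zord_cancel (entire_shift tau hh) _ Tz').
    apply: entireM => //; have := ec_affine_entire (- (N - N')%:~R) (- (s - s')).
    by congr entireH; apply/funext => u; rewrite mulNr.
  move=> z; set e' := ec (- (N'%:~R * z) - s').
  have e'0 : e' != 0 by exact: ec_neq0.
  apply: (mulIf e'0).
  have -> : h (z + tau) * Th z * e' = g (z + tau) by rewrite -mulrA -Tgt -hE.
  rewrite gt hE.
  have -> : ec (- (N%:~R * z) - s) = ec (- ((N - N')%:~R * z) - (s - s')) * e'.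
    by rewrite -ecD rmorphB /=; congr ec; ring.
  by ring.
have [/eqP NN Ls] := qper_neq0 h0 hq.
rewrite subr_eq0 in NN; split; first exact/eqP.
by move: Ls; rewrite /s' opprK addrA.
Qed.

End Theta.

(** * Comparison of the two maps *)

Section Normalization.
Variable R : realType.
Local Notation C := R[i].
Variable tau : C.
Hypothesis tau_gt0 : 0 < complex.Im tau.
Implicit Types (z w b s : C) (f g h : C -> C) (N : int).

Lemma fundamental_parallelogramP D : fundamental_parallelogram tau D ->
  (forall z, exists2 w, inL tau w & D (z - w)) /\
  (forall z z', D z -> D z' -> inL tau (z - z') -> z = z').
Proof.
move=> [c [w1 [w2 [LE ->]]]].
have L w : inL tau w <-> lattice w1 w2 w.
  by rewrite LE; split=> -[k [l ->]]; exists k, l; rewrite mulr1.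
have [k1 [l1 e1]] := (L 1).1 (inL_int tau 1).
have [kt [lt et]] := (L tau).1 (inL_tau tau).
pose det := complex.Re w1 * complex.Im w2 - complex.Im w1 * complex.Re w2.
have ReIm (s t : R) : complex.Re (s%:C * w1 + t%:C * w2)
      = s * complex.Re w1 + t * complex.Re w2 /\
    complex.Im (s%:C * w1 + t%:C * w2) = s * complex.Im w1 + t * complex.Im w2.
  by case: (w1) (w2) => [? ?] [? ?] /=; split; ring.
(* As 1 and [tau] are integral combinations of [w1] and [w2], the nonzero [Im tau] is an integer
   multiple of [det]. *)
have det0 : det != 0.
  have {}e1 : 1 = k1%:~R%:C * w1 + l1%:~R%:C * w2 by rewrite !rmorph_int.
  have {}et : tau = kt%:~R%:C * w1 + lt%:~R%:C * w2 by rewrite !rmorph_int.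
  have [r1 i1] := ReIm k1%:~R l1%:~R; have [rt it] := ReIm kt%:~R lt%:~R.
  rewrite -e1 /= in r1 i1; rewrite -et in rt it.
  move: tau_gt0; apply: contraTneq => d0.
  have -> : complex.Im tau = (k1%:~R * lt%:~R - l1%:~R * kt%:~R) * det.
    have -> : (k1%:~R * lt%:~R - l1%:~R * kt%:~R) * det =
      (k1%:~R * complex.Re w1 + l1%:~R * complex.Re w2) *
        (kt%:~R * complex.Im w1 + lt%:~R * complex.Im w2) -
      (k1%:~R * complex.Im w1 + l1%:~R * complex.Im w2) *
        (kt%:~R * complex.Re w1 + lt%:~R * complex.Re w2) by rewrite /det; ring.
    by rewrite -r1 -i1 -rt -it mul1r mul0r subr0.
  by rewrite d0 mulr0 ltxx.
have free (s t : R) : s%:C * w1 + t%:C * w2 = 0 -> s = 0 /\ t = 0.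
  move=> E; have [] := ReIm s t; rewrite E /= => h1 h2.
  split; apply: (mulIf det0); rewrite mul0r /det.
    have -> : s * (complex.Re w1 * complex.Im w2 - complex.Im w1 * complex.Re w2) =
      (s * complex.Re w1 + t * complex.Re w2) * complex.Im w2 -
      (s * complex.Im w1 + t * complex.Im w2) * complex.Re w2 by ring.
    by rewrite -h1 -h2 !mul0r subrr.
  have -> : t * (complex.Re w1 * complex.Im w2 - complex.Im w1 * complex.Re w2) =
      (s * complex.Im w1 + t * complex.Im w2) * complex.Re w1 -
      (s * complex.Re w1 + t * complex.Re w2) * complex.Im w1 by ring.
  by rewrite -h1 -h2 !mul0r subrr.
split=> [z|z z' [s [t [s01 t01 ->]]] [s' [t' [s01' t01' ->]]] /L[k [l E]]].
  pose x := complex.Re (z - c); pose y := complex.Im (z - c).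
  (* Cramer's rule for the real coordinates of [z - c] in the basis [w1], [w2]; their floors give
     the lattice vector to subtract. *)
  pose s := (x * complex.Im w2 - y * complex.Re w2) / det.
  pose t := (complex.Re w1 * y - complex.Im w1 * x) / det.
  have zE : z - c = s%:C * w1 + t%:C * w2.
    have [h1 h2] := ReIm s t.
    apply/eqP; rewrite eq_complex h1 h2 -/x -/y.
    by rewrite /s /t /det; apply/andP; split; apply/eqP; field.
  exists ((Num.floor s)%:~R * w1 + (Num.floor t)%:~R * w2).
    by apply/L; exists (Num.floor s), (Num.floor t).
  have fl (r : R) : 0 <= r - (Num.floor r)%:~R < 1.
    have := floor_itv r; rewrite rmorphD /=.
    by move=> /andP[? ?]; apply/andP; split; lra.
  exists (s - (Num.floor s)%:~R), (t - (Num.floor t)%:~R); split=> //.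
  rewrite !rmorphB /= !rmorph_int -[z in LHS](subrK c) zE.
  by ring.
have [E1 E2] : s - s' - k%:~R = 0 /\ t - t' - l%:~R = 0.
  apply: free; rewrite !rmorphB /= !rmorph_int.
  have -> : (s%:C - s'%:C - k%:~R) * w1 + (t%:C - t'%:C - l%:~R) * w2 =
    (c + s%:C * w1 + t%:C * w2 - (c + s'%:C * w1 + t'%:C * w2)) -
    (k%:~R * w1 + l%:~R * w2) by ring.
  by rewrite E subrr.
have int0 (m : int) : -1 < (m%:~R : R) < 1 -> m = 0.
  move=> /andP[h1 h2]; have : -1 < m by rewrite -(ltr_int R) rmorphN.
  have : m < 1 by rewrite -(ltr_int R).
  lia.
move: s01 t01 s01' t01' => /andP[? ?] /andP[? ?] /andP[? ?] /andP[? ?].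
have k0 : k = 0 by apply: int0; apply/andP; split; lra.
have l0 : l = 0 by apply: int0; apply/andP; split; lra.
rewrite k0 subr0 in E1; rewrite l0 subr0 in E2.
by have -> : s = s' by [lra]; have -> : t = t' by [lra].
Qed.

Lemma entire_entireH f : entire f -> entireH f.
Proof. by move=> fh z; apply: derivable_holo; exact: fh. Qed.

(* A Gaussian factor makes all the functions 1-periodic and turns the second
   multiplier into [ec (- N u - s)]. *)
Lemma qper_normalization (I : Type) (f : I -> C -> C) :
  (forall i, entire (f i)) -> same_quasi_periodicity tau f ->
  (exists i u, f i u != 0) ->
  exists (e : C -> C) N s, [/\ entireH e, forall u, e u != 0 &
    forall i, qper tau N s (fun u => e u * f i u)].
Proof.
move=> fh [l1 [lt [c1 [ct qp]]]] [i0 [u0 f0]].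
have q1 i u : f i (u + 1) = f i u * ec (l1 * u + c1) by case: (qp i u).
have qt i u : f i (u + tau) = f i u * ec (lt * u + ct) by case: (qp i u).
(* Computing [f i0 (u0 + 1 + tau)] in both orders and cancelling the nonzero value at [u0] gives
   [ec (l1 * tau - lt) = 1]. *)
have [N NE] : exists N : int, l1 * tau - lt = N%:~R.
  apply: ec_eq1; have := q1 i0 (u0 + tau); rewrite addrAC !qt q1 -2!(mulrA (f i0 u0)) -!ecD.
  move=> /(mulfI f0) E.
  apply: (mulIf (ec_neq0 (l1 * u0 + c1 + (lt * (u0 + 1) + ct)))).
  by rewrite mul1r [RHS]E -ecD; congr ec; ring.
(* The quadratic exponent Q solves Q(u+1) - Q(u) = - l1 u - c1; the constant [s] below is then read
   off from Q(u+tau) - Q(u) + lt u + ct. *)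
pose e u := ec ((- l1 / 2 * u + (l1 / 2 - c1)) * u).
exists e, N, (c1 * tau - ct + l1 * tau ^+ 2 / 2 - l1 * tau / 2); split.
- move=> u; apply: holo_comp; first exact: holo_ec.
  apply: holoM; last exact: holo_id.
  apply: holoD; last exact: holo_cst.
  by apply: holoM; [exact: holo_cst | exact: holo_id].
- by move=> u; exact: ec_neq0.
move=> i; split.
- apply: entireM; last exact: entire_entireH.
  move=> u; apply: holo_comp; first exact: holo_ec.
  apply: holoM; last exact: holo_id.
  apply: holoD; last exact: holo_cst.
  by apply: holoM; [exact: holo_cst | exact: holo_id].
- move=> u; rewrite q1 mulrCA mulrC -ecD; congr (ec _ * _).
  by field.
move=> u; rewrite qt -NE mulrCA mulrC -ecD [RHS]mulrAC -ecD; congr (ec _ * _).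
by field.
Qed.

(** Passage from zeros in [D] to zeros modulo the lattice: [z] has one representative in [D], so the
    listed zeros congruent to [z] are exactly the occurrences of that representative. *)
Lemma qper_zeros D N s g (zs : seq C) : fundamental_parallelogram tau D ->
  qper tau N s g -> (forall z, z \in zs -> D z) ->
  (forall z, D z -> zord g z (count_mem z zs)) ->
  N = (size zs)%:Z /\ inL tau (s + \sum_(b <- zs) b + (size zs)%:R / 2).
Proof.
move=> /fundamental_parallelogramP[D1 D2] gq zsD gz.
apply: (zeros_quasi_period tau_gt0 gq) => z.
have [w Lw Dw] := D1 z.
have -> : count (fun b => `[< inL tau (z - b) >]) zs = count_mem (z - w) zs.
  apply: eq_in_count => b bz /=; apply/asboolP/eqP => [Lzb|->].
    apply: D2 => //; first exact: zsD.
    by have -> : b - (z - w) = w - (z - b) by [ring]; exact: inLB.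
  by rewrite opprB addrC subrK.
rewrite -[z in zord g z _](subrK w); apply: zord_mult_period; last exact: gz.
exact: qper_mult_period gq Lw.
Qed.

Lemma qperD N s f g : qper tau N s f -> qper tau N s g -> qper tau N s (fun u => f u + g u).
Proof.
move=> [fh f1 ft] [gh g1 gt]; split=> [u|u|u]; first exact: holoD.
  by rewrite f1 g1.
by rewrite ft gt mulrDl.
Qed.

Lemma qperZ N s c f : qper tau N s f -> qper tau N s (fun u => c * f u).
Proof.
move=> [fh f1 ft]; split=> [u|u|u]; last by rewrite ft mulrA.
  by apply: holoM; [exact: holo_cst | exact: fh].
by rewrite f1.
Qed.

Lemma qper_sum N s (I : Type) (r : seq I) (f : I -> C -> C) :
  (forall i, qper tau N s (f i)) -> qper tau N s (fun u => \sum_(i <- r) f i u).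
Proof.
move=> fq; elim: r => [|i r IH].
  have -> : (fun u => \sum_(i <- [::]) f i u) = (fun=> 0).
    by apply/funext => u; rewrite big_nil.
  by split=> [u|//|u]; [exact: holo_cst | rewrite mul0r].
have -> : (fun u => \sum_(j <- i :: r) f j u) = (fun u => f i u + \sum_(j <- r) f j u).
  by apply/funext => u; rewrite big_cons.
exact: qperD.
Qed.

Lemma qper_int N s (k : int) f : qper tau N (s + k%:~R) f -> qper tau N s f.
Proof.
move=> [fh f1 ft]; split=> // u; rewrite ft; congr (_ * _).
by rewrite opprD addrA ecD ecN ec_int invr1 mulr1.
Qed.

Variables (n : nat) (s : C).
Implicit Types F G : 'I_n.+1 -> C -> C.

Definition coef_mx F : 'M[C]_n.+1 := \matrix_(i, j) fcoef (F i) (j : nat)%:Z.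

Lemma coef_mx_inj F (v : 'rV[C]_n.+1) : (forall i, qper tau n.+1%:Z s (F i)) ->
  v *m coef_mx F = 0 -> forall u, \sum_i v 0 i * F i u = 0.
Proof.
move=> Fq vF; apply: (@qper_coef_inj _ tau n s).
  by apply: qper_sum => i; exact: qperZ.
move=> j; rewrite fcoef_sum; last by move=> i; case: (Fq i).
have /rowP/(_ j) := vF; rewrite !mxE => E.
by rewrite -[RHS]E; apply: eq_bigr => i _; rewrite mxE.
Qed.

(** A row vector killed by the matrix is a combination of the [F i] whose first n+1 Fourier
    coefficients vanish, hence a linear relation. *)
Lemma coef_mx_unit F : (forall i, qper tau n.+1%:Z s (F i)) -> linearly_independent F ->
  coef_mx F \in unitmx.
Proof.
move=> Fq Ff; rewrite -row_free_unit; apply: inj_row_free => v vF.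
apply/rowP => i; rewrite mxE; apply: (Ff (fun i => v 0 i)).
exact: coef_mx_inj.
Qed.

Lemma qper_basis_change F G : (forall i, qper tau n.+1%:Z s (F i)) ->
  (forall i, qper tau n.+1%:Z s (G i)) -> linearly_independent F -> linearly_independent G ->
  exists2 M : 'M[C]_n.+1, M \in unitmx &
    forall u, coords G u = coords F u *m M.
Proof.
move=> Fq Gq Ff Gf; have FU := coef_mx_unit Fq Ff; have GU := coef_mx_unit Gq Gf.
pose M := coef_mx G *m invmx (coef_mx F).
(* The rows of [M] express each [G j] through the [F i]; acting on row vectors from the right
   requires the transpose. *)
exists M^T; first by rewrite unitmx_tr unitmx_mul GU unitmx_inv.
move=> u; apply/rowP => j; rewrite !mxE.
have MF : M *m coef_mx F = coef_mx G by rewrite mulmxKV.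
apply/eqP; rewrite eq_sym -subr_eq0; apply/eqP.
have -> : \sum_i coords F u 0 i * M^T i j = \sum_i M j i * F i u.
  by apply: eq_bigr => i _; rewrite !mxE mulrC.
rewrite -mulN1r; move: u.
have Fh i : entireH (F i) by case: (Fq i).
have Gh : entireH (G j) by case: (Gq j).
have Sq : qper tau n.+1%:Z s (fun u => \sum_i M j i * F i u).
  by apply: qper_sum => i; exact: qperZ.
apply: (@qper_coef_inj _ tau n s).
  by apply: qperD => //; exact: qperZ.
move=> k; rewrite fcoefD ?fcoefZ ?fcoef_sum //; last 2 first.
- by case: Sq.
- by apply: entireM => // u; exact: holo_cst.
have /matrixP/(_ j k) := MF; rewrite !mxE => <-.
apply/eqP; rewrite mulN1r subr_eq0; apply/eqP.
by apply: eq_bigr => i _; rewrite !mxE.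
Qed.

End Normalization.

Theorem proposition3p2 (R : realType) (tau : R[i])
  (tau_gt0 : 0 < complex.Im tau)
  (D : set R[i]) (hD : fundamental_parallelogram tau D)
  (n : nat) (f f' : 'I_n.+1 -> R[i] -> R[i])
  (f_entire : forall i, entire (f i))
  (f_neq0 : forall u, coords f u != 0)
  (f_qper : same_quasi_periodicity tau f)
  (f_free : linearly_independent f)
  (f_zeros : forall i, exists zs : n.+1.-tuple R[i], zeros_in D (f i) zs)
  (f'_entire : forall i, entire (f' i))
  (f'_neq0 : forall u, coords f' u != 0)
  (f'_qper : same_quasi_periodicity tau f')
  (f'_free : linearly_independent f')
  (f'_zeros : forall i, exists zs : n.+1.-tuple R[i], zeros_in D (f' i) zs)
  (u_ : n.+1.-tuple R[i]) (hu : zeros_in D (f ord0) u_)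
  (u'_ : n.+1.-tuple R[i]) (hu' : zeros_in D (f' ord0) u'_) :
  let a : R[i] :=
    n.+1%:R^-1 * (\sum_(z <- u'_) z - \sum_(z <- u_) z) in
  exists G : PGL R[i] n,
    forall u : R[i], PGL_act (proj_map f_neq0 u) G = proj_map f'_neq0 (u + a).
Proof.
move=> a.
have ex_neq0 (g : 'I_n.+1 -> R[i] -> R[i]) : (forall u, coords g u != 0) ->
    exists i u, g i u != 0.
  move=> /(_ 0) /eqP g0; apply: contrapT => H; apply: g0; apply/rowP => i.
  by rewrite !mxE; apply/eqP/negPn/negP => gi; apply: H; exists i, 0.
have norm (g : 'I_n.+1 -> R[i] -> R[i]) (zs : n.+1.-tuple R[i]) :
    (forall i, entire (g i)) -> (forall u, coords g u != 0) ->
    same_quasi_periodicity tau g -> zeros_in D (g ord0) zs ->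
    exists (e : R[i] -> R[i]) s, [/\ forall u, e u != 0, entireH e,
      forall i, qper tau n.+1%:Z s (fun u => e u * g i u) &
      inL tau (s + \sum_(b <- zs) b + n.+1%:R / 2)].
  move=> gh g0 gq [zD zg].
  have [e [N [s [eh e0 eq]]]] := qper_normalization gh gq (ex_neq0 _ g0).
  have [|NE Ls] := qper_zeros tau_gt0 hD (eq ord0) zD.
    (* The normalizing factor has order 0 everywhere, so the zeros keep their multiplicities. *)
    move=> z /zg /zero_order_zord; rewrite -[count_mem z zs]add0n; apply: zordM.
    exact: zord0.
  by rewrite size_tuple in NE Ls; exists e, s; rewrite -NE.
have [e [s [e0 eh Fq Ls]]] := norm f u_ f_entire f_neq0 f_qper hu.
have [e' [s' [e'0 e'h Fq' Ls']]] := norm f' u'_ f'_entire f'_neq0 f'_qper hu'.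
have n0 : n.+1%:R != 0 :> R[i] by rewrite pnatr_eq0.
have [k [l kl]] : inL tau (s' + n.+1%:R * a - s).
  have := inLB Ls' Ls; congr (inL _ _).
  by rewrite /a mulVKf //; ring.
pose F i u := e u * f i u.
pose F' i u := ec (l%:~R * u) * (e' (u + a) * f' i (u + a)).
have lq : qper tau 0 (- (l%:~R * tau)) (fun u => ec (l%:~R * u)).
  split; first exact: entire_ecZ.
    by move=> u; rewrite mulrDr mulr1 ecD ec_int mulr1.
  by move=> u; rewrite mulr0z mul0r oppr0 add0r opprK mulrDr ecD.
have F'q i : qper tau n.+1%:Z s (F' i).
  apply: (@qper_int _ tau _ _ k); have := qperM lq (qper_shift a (Fq' i)).
  congr (qper _ _ _ _); rewrite ?add0r //.
  have -> : s + k%:~R = s + (k%:~R + l%:~R * tau) - l%:~R * tau by ring.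
  by rewrite -kl; ring.
have F_free : linearly_independent F.
  move=> c H; apply: f_free => u; apply: (mulfI (e0 u)); rewrite mulr0 -[RHS](H u).
  by rewrite mulr_sumr; apply: eq_bigr => i _; rewrite /F mulrCA.
have F'_free : linearly_independent F'.
  move=> c H; apply: f'_free => u.
  apply: (mulfI (mulf_neq0 (ec_neq0 (l%:~R * (u - a))) (e'0 u))).
  rewrite mulr0 -[RHS](H (u - a)) mulr_sumr; apply: eq_bigr => i _.
  by rewrite /F' subrK; ring.
have [M MU FM] := qper_basis_change Fq F'q F_free F'_free.
exists (\pi_(PGL R[i] n)%qT (GLMx MU)) => u.
rewrite /proj_map {1}/proj_point PGL_actE.
apply/proj_pointP.
pose d := ec (l%:~R * u) * e' (u + a).
have d0 : d != 0 by rewrite mulf_neq0 ?ec_neq0.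
(* The normalizing factors vary with [u] but not with the index [i], so they give only a homogeneous
   scalar. *)
exists (e u / d); first by rewrite mulf_neq0 ?invr_eq0.
apply: (scalerI d0); rewrite scalerA mulrCA mulfV // mulr1 /= scalemxAl.
have -> : d *: coords f' (u + a) = coords F' u.
  by apply/rowP => i; rewrite !mxE /F' /d mulrA.
have -> : e u *: coords f u = coords F u by apply/rowP => i; rewrite !mxE.
exact: FM.
Qed.
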